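(* Let $p\ge3$ be a prime. For all $n,k\ge0$, $$b\!\left(108p^{2\nu(p)k}n+\frac{153p^{2\nu(p)k}-1}{2}\right)\equiv 0\pmod{72}.$$
   Context: The mock theta function $\mathcal{B}(q)=\sum_{n\ge0}\frac{q^n(-q;q^2)_n}{(q;q^2)_{n+1}}=\sum_{n\ge0}b(n)q^n$, $(a;q)_n=\prod_{j=0}^{n-1}(1-aq^j)$. The integers $a(n)$ are defined by $\sum_{n\ge0}a(n)q^n=f_1^4f_2$, $f_m:=(q^m;q^m)_\infty$. For a prime $p\ge3$: $r=r(p):=a\!\left(\frac{p^2-1}{4}\right)+(-1)^{\frac{p-1}{2}}\,p\left(\frac{(p^2-1)/4}{p}\right)$ (Legendre symbol); $r$ is even. Set $\nu(p)=2$ if $r\equiv0\pmod 8$, $\nu(p)=4$ if $r\equiv4\pmod8$, $\nu(p)=8$ if $r\equiv2\pmod4$. *)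

(* Defs.v *)
(* Formal power series with integer coefficients are
   represented by their coefficient sequences  nat -> int. *)
From mathcomp Require Import all_boot all_order all_algebra.
Set Implicit Arguments. Unset Strict Implicit. Unset Printing Implicit Defensive.
Import Order.TTheory GRing.Theory Num.Theory.
Local Open Scope ring_scope.

Definition fps := nat -> int.

Definition fps_mul (f g : fps) : fps :=
  fun n => \sum_(i < n.+1) f i * g (n - i)%N.

Definition fps_one : fps := fun n => (n == 0%N)%:R.

Definition fps_X (m : nat) : fps := fun n => (n == m)%:R.

Definition fps_binom (c : int) (k : nat) : fps :=
  fun n => (n == 0%N)%:R + c * (n == k)%:R.

(* 1 / (1 - q^k), valid for k >= 1 *)
Definition fps_geom (k : nat) : fps := fun n => (k %| n)%N%:R.

Definition fps_prod (s : seq fps) : fps := foldr fps_mul fps_one s.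

Definition negq_q2 (n : nat) : fps :=
  fps_prod [seq fps_binom 1 (2 * j).+1 | j <- iota 0 n].

Definition inv_q_q2 (n : nat) : fps :=
  fps_prod [seq fps_geom (2 * j).+1 | j <- iota 0 n.+1].

Definition B_term (n : nat) : fps :=
  fps_mul (fps_X n) (fps_mul (negq_q2 n) (inv_q_q2 n)).

(* b(N): coefficient of q^N in B(q); summands with n > N are divisible by
   q^{N+1} and do not contribute. *)
Definition b (N : nat) : int := \sum_(n < N.+1) B_term n N.

(* f_m truncated: prod_{j=1}^{N} (1 - q^{m j}); factors with j > N do not
   affect coefficients of index <= N (for m >= 1). *)
Definition f_trunc (m N : nat) : fps :=
  fps_prod [seq fps_binom (-1) (m * j) | j <- iota 1 N].

Definition a (N : nat) : int :=
  fps_mul (fps_mul (fps_mul (f_trunc 1 N) (f_trunc 1 N))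
                   (fps_mul (f_trunc 1 N) (f_trunc 1 N)))
          (f_trunc 2 N) N.

Definition legendre (x p : nat) : int :=
  if (p %| x)%N then 0
  else if [exists y : 'I_p, (y ^ 2 == x %[mod p])%N] then 1 else -1.

Definition r (p : nat) : int :=
  let m := ((p ^ 2 - 1) %/ 4)%N in
  a m + (-1) ^+ ((p - 1) %/ 2)%N * p%:Z * legendre m p.

(* nu(p): 2 if r = 0 mod 8, 4 if r = 4 mod 8, 8 if r = 2 mod 4
   (r is always even; the last branch is only reached when r = 2 mod 4). *)
Definition nu (p : nat) : nat :=
  if (r p %% 8 == 0)%Z then 2%N
  else if (r p %% 8 == 4)%Z then 4%N
  else 8%N.

(* Main.v *)
(* Let S = B(q) + B(-q), i.e. twice the even part of B.  The terms of B(-q) are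
   the terms of B(q) with negative index, so S is a bilateral 1psi1 series, and
   Ramanujan's summation gives S f_2^4 = 2 f_4^5, that is
   S phi(-q^2) = 2 psi(q^2)^2 with Gauss' theta functions phi and psi.
   - Modulo 9: 3-dissecting phi(-q) = a - 2 q w and psi(q) = P + q s, where
     P w = s a by the triple product, and multiplying by a^2 + 2 q a w + 4 q^2 w^2,
     the part of psi^2 / phi(-q) with exponents = 2 mod 3 is
     9 q^2 (s a)^2 / (a^3 - 8 q^3 w^3); hence b(6t+4) = 0 mod 9 for all t.
   - Modulo 8: psi(q)^2 = phi(q) psi(q^2), and 2-dissecting phi shows that the even
     part of psi^2 / phi(-q) is congruent to psi(q^2) mod 8; hence
     b(4n) = 0 mod 8 unless n is triangular.
   The index of the theorem is = 4 mod 6 and equals 4n with 8n + 1 = (3R)^2 (24m + 17),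
   where R^2 is the power of p, and 24m + 17 is not a square. *)
Require Import Defs.
From HB Require Import structures.
From mathcomp Require Import all_boot all_order all_algebra.
From mathcomp Require Import boolp ring zify.
Local Open Scope ring_scope.
Set Implicit Arguments.
Unset Strict Implicit.
Unset Printing Implicit Defensive.
Import Order.TTheory GRing.Theory Num.Theory.

(** * The ring of formal power series *)

Definition fps_zero : fps := fun=> 0.
Definition fps_add (f g : fps) : fps := fun n => f n + g n.
Definition fps_opp (f : fps) : fps := fun n => - f n.

(** Truncations transport commutativity and associativity of the Cauchy product from
    [{poly int}]. *)
Definition trunc (N : nat) (f : fps) : {poly int} := \poly_(i < N) f i.

Lemma coef_trunc_mul N n (f g : fps) : (n < N)%N ->
  (trunc N f * trunc N g)`_n = fps_mul f g n.
Proof.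
move=> nN; rewrite coefM; apply: eq_bigr => i _.
by rewrite !coef_poly !ifT //; have := ltn_ord i; lia.
Qed.

(** The left factor may be any polynomial agreeing with [f] below [N], in particular a product of
    two truncations; this is what associativity requires. *)
Lemma trunc_mul N n (f : fps) (p : {poly int}) : (n < N)%N ->
  (forall i, (i < N)%N -> p`_i = f i) ->
  forall g, (p * trunc N g)`_n = fps_mul f g n.
Proof.
move=> nN pf g; rewrite coefM; apply: eq_bigr => i _.
by rewrite coef_poly pf ?ifT //; have := ltn_ord i; lia.
Qed.

Lemma fps_addA : associative fps_add.
Proof. by move=> f g h; apply/funext => n; rewrite /fps_add addrA. Qed.

Lemma fps_addC : commutative fps_add.
Proof. by move=> f g; apply/funext => n; rewrite /fps_add addrC. Qed.

Lemma fps_add0 : left_id fps_zero fps_add.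
Proof. by move=> f; apply/funext => n; rewrite /fps_add add0r. Qed.

Lemma fps_addN : left_inverse fps_zero fps_opp fps_add.
Proof. by move=> f; apply/funext => n; rewrite /fps_add /fps_opp addNr. Qed.

Lemma fps_mulC : commutative fps_mul.
Proof.
by move=> f g; apply/funext => n; rewrite -!(@coef_trunc_mul n.+1) // mulrC.
Qed.

Lemma fps_mulA : associative fps_mul.
Proof.
move=> f g h; apply/funext => n.
rewrite fps_mulC -(@trunc_mul n.+1 n _ (trunc n.+1 g * trunc n.+1 h)) //.
  rewrite -(@trunc_mul n.+1 n _ (trunc n.+1 f * trunc n.+1 g)) //.
    by rewrite mulrC mulrA.
  by move=> i iN; rewrite coef_trunc_mul.
by move=> i iN; rewrite coef_trunc_mul.
Qed.

Lemma fps_mul1 : left_id fps_one fps_mul.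
Proof.
move=> f; apply/funext => n; rewrite /fps_mul big_ord_recl subn0 mul1r.
by rewrite big1 ?addr0 // => i _; rewrite /fps_one /= mul0r.
Qed.

Lemma fps_mulDl : left_distributive fps_mul fps_add.
Proof.
move=> f g h; apply/funext => n; rewrite /fps_mul /fps_add -big_split /=.
by apply: eq_bigr => i _; rewrite mulrDl.
Qed.

HB.instance Definition _ := Choice.copy fps (nat -> int).
HB.instance Definition _ :=
  GRing.isZmodule.Build fps fps_addA fps_addC fps_add0 fps_addN.
Lemma fps_oner_neq0 : fps_one != 0 :> fps.
Proof. by apply/eqP => /(congr1 (fun f : fps => f 0%N)). Qed.
HB.instance Definition _ := GRing.Zmodule_isComNzRing.Build fps
  fps_mulA fps_mulC fps_mul1 fps_mulDl fps_oner_neq0.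

(** Inverses are chosen classically; off the units the value is [f] itself, the default imposed by
    the unit ring structure. *)
Definition fps_inv (f : fps) : fps :=
  if pselect (exists g, g * f = 1) is left fP then projT1 (cid fP) else f.

Lemma fps_mulVr : {in [pred f : fps | `[< exists g, g * f = 1 >]],
  left_inverse 1 fps_inv *%R}.
Proof.
move=> f /asboolP fP; rewrite /fps_inv; case: pselect => // fP'.
by case: (cid fP').
Qed.

Lemma fps_unitP (f g : fps) : g * f = 1 ->
  [pred f : fps | `[< exists g, g * f = 1 >]] f.
Proof. by move=> gf; apply/asboolP; exists g. Qed.

Lemma fps_inv_out :
  {in [predC [pred f : fps | `[< exists g, g * f = 1 >]]], fps_inv =1 id}.
Proof.
by move=> f /asboolPn fP; rewrite /fps_inv; case: pselect => // /fP.
Qed.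

HB.instance Definition _ := GRing.ComNzRing_hasMulInverse.Build fps
  fps_mulVr fps_unitP fps_inv_out.

Notation X := (fps_X 1).

Lemma fcoefD (f g : fps) n : (f + g) n = f n + g n. Proof. by []. Qed.
Lemma fcoefN (f : fps) n : (- f) n = - f n. Proof. by []. Qed.
Lemma fcoefM (f g : fps) n : (f * g) n = \sum_(i < n.+1) f i * g (n - i)%N.
Proof. by []. Qed.
Lemma fcoef1 n : (1 : fps) n = (n == 0%N)%:R. Proof. by []. Qed.
Lemma fcoefMn (f : fps) k n : (f *+ k) n = f n *+ k.
Proof. by elim: k => // k IH; rewrite !mulrS fcoefD IH. Qed.
Lemma fcoef_sum I (r : seq I) (P : pred I) (F : I -> fps) n :
  (\sum_(i <- r | P i) F i) n = \sum_(i <- r | P i) F i n.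
Proof. exact: (big_morph (fun f : fps => f n)). Qed.

Lemma coef_fps_X_mul k (f : fps) n :
  (fps_X k * f) n = if (n < k)%N then 0 else f (n - k)%N.
Proof.
rewrite /GRing.mul /= /fps_mul; case: ltnP => kn.
  by rewrite big1 // => i _; rewrite /fps_X ltn_eqF ?mul0r //; have := ltn_ord i; lia.
rewrite (bigD1 (Ordinal (kn : k < n.+1)%N)) //= /fps_X eqxx mul1r big1 ?addr0 //.
by move=> i; rewrite -val_eqE /= => /negPf ->; rewrite mul0r.
Qed.

Lemma fps_XE k : fps_X k = X ^+ k.
Proof.
elim: k => [//|k IH]; rewrite exprS -IH; apply/funext => n.
by rewrite coef_fps_X_mul /fps_X; case: n => // n; rewrite subn1.
Qed.

Lemma fcoefXM k (f : fps) n :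
  (X ^+ k * f) n = if (n < k)%N then 0 else f (n - k)%N.
Proof. by rewrite -fps_XE coef_fps_X_mul. Qed.

Lemma fcoefX k n : (X ^+ k) n = (n == k)%:R. Proof. by rewrite -fps_XE. Qed.

Lemma mulXn_inj k (f g : fps) : X ^+ k * f = X ^+ k * g -> f = g.
Proof.
move=> e; apply/funext => n; have := congr1 (fun h : fps => h (k + n)%N) e.
by rewrite !fcoefXM ltnNge leq_addr /= addnC addnK.
Qed.

(** * Congruence modulo a power of [X], and limits *)

Definition eqX (N : nat) (f g : fps) := forall i, (i < N)%N -> f i = g i.

Lemma eqX_refl N (f : fps) : eqX N f f. Proof. by []. Qed.
Lemma eqX_sym N (f g : fps) : eqX N f g -> eqX N g f.
Proof. by move=> e i iN; rewrite e. Qed.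
Lemma eqX_trans N (f g h : fps) : eqX N f g -> eqX N g h -> eqX N f h.
Proof. by move=> e e' i iN; rewrite e ?e'. Qed.
Lemma eqX_leq M N (f g : fps) : (M <= N)%N -> eqX N f g -> eqX M f g.
Proof. by move=> MN e i iM; apply: e; lia. Qed.
Lemma eqXD N (f f' g g' : fps) : eqX N f f' -> eqX N g g' -> eqX N (f + g) (f' + g').
Proof. by move=> e e' i iN; rewrite !fcoefD e ?e'. Qed.
Lemma eqXN N (f f' : fps) : eqX N f f' -> eqX N (- f) (- f').
Proof. by move=> e i iN; rewrite !fcoefN e. Qed.
Lemma eqXM N (f f' g g' : fps) : eqX N f f' -> eqX N g g' -> eqX N (f * g) (f' * g').
Proof.
move=> e e' i iN; apply: eq_bigr => j _.
by rewrite e ?e' //; have := ltn_ord j; lia.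
Qed.
Lemma eqX_mul0 N (f g : fps) : eqX N f 0 -> eqX N (f * g) 0.
Proof. by move=> e; rewrite -[0](mul0r g); apply: eqXM. Qed.
Lemma eqX_Xn N k : (N <= k)%N -> eqX N (X ^+ k) 0.
Proof. by move=> Nk i iN; rewrite fcoefX ltn_eqF // (leq_trans iN). Qed.
Lemma eqX_XnM N k (f : fps) : (N <= k)%N -> eqX N (X ^+ k * f) 0.
Proof. by move=> Nk; apply/eqX_mul0/eqX_Xn. Qed.
Lemma eqX_exp0 N (f : fps) : f 0%N = 0 -> eqX N (f ^+ N) 0.
Proof.
move=> f0; elim: N => // N IH i iN; rewrite exprS.
rewrite [LHS]big_ord_recl f0 mul0r add0r big1 // => j _.
by rewrite IH ?mulr0 //=; have := ltn_ord j; rewrite /bump /=; lia.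
Qed.
Lemma eqX_sum N I (r : seq I) (P : pred I) (F G : I -> fps) :
  (forall i, P i -> eqX N (F i) (G i)) ->
  eqX N (\sum_(i <- r | P i) F i) (\sum_(i <- r | P i) G i).
Proof. by move=> FG; apply: (big_ind2 (eqX N)) => // *; apply: eqXD. Qed.
Lemma eqX_prod N I (r : seq I) (P : pred I) (F G : I -> fps) :
  (forall i, P i -> eqX N (F i) (G i)) ->
  eqX N (\prod_(i <- r | P i) F i) (\prod_(i <- r | P i) G i).
Proof. by move=> FG; apply: (big_ind2 (eqX N)) => // *; apply: eqXM. Qed.
Lemma eqXP (f g : fps) : (forall N, eqX N f g) -> f = g.
Proof. by move=> e; apply/funext => n; apply: (e n.+1). Qed.

Definition cvg_fps (s : nat -> fps) (f : fps) :=
  forall N, exists M, forall n, (M <= n)%N -> eqX N (s n) f.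

(** Coefficient [n] is read off [s n.+1]; this is the limit once [s n] and [s n.+1] agree below
    degree [n] for every [n]. *)
Definition lim_fps (s : nat -> fps) : fps := fun n => s n.+1 n.

Lemma lim_eqX s : (forall n, eqX n (s n) (s n.+1)) ->
  forall n, eqX n (s n) (lim_fps s).
Proof.
move=> sP n i; rewrite /lim_fps.
elim: n => // n IH; rewrite ltnS leq_eqVlt => /orP[/eqP->//|lin].
by rewrite -sP ?IH.
Qed.

Lemma cvg_const (f : fps) : cvg_fps (fun=> f) f.
Proof. by move=> N; exists 0%N. Qed.

Lemma cvg_eqX s (f : fps) : (forall n, eqX n (s n) f) -> cvg_fps s f.
Proof. by move=> sf N; exists N => n Nn; apply: eqX_leq (sf n). Qed.

Lemma lim_fpsP s : (forall n, eqX n (s n) (s n.+1)) -> cvg_fps s (lim_fps s).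
Proof. by move=> /lim_eqX/cvg_eqX. Qed.

Lemma cvg_ext s t (f : fps) : s =1 t -> cvg_fps s f -> cvg_fps t f.
Proof. by move=> /funext ->. Qed.

Lemma cvgD s t (f g : fps) : cvg_fps s f -> cvg_fps t g ->
  cvg_fps (fun n => s n + t n) (f + g).
Proof.
move=> sf tg N; have [M Ms] := sf N; have [M' Mt] := tg N.
by exists (maxn M M') => n; rewrite geq_max => /andP[? ?]; apply: eqXD; auto.
Qed.

Lemma cvgN s (f : fps) : cvg_fps s f -> cvg_fps (fun n => - s n) (- f).
Proof. by move=> sf N; have [M Ms] := sf N; exists M => n /Ms; apply: eqXN. Qed.

Lemma cvgM s t (f g : fps) : cvg_fps s f -> cvg_fps t g ->
  cvg_fps (fun n => s n * t n) (f * g).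
Proof.
move=> sf tg N; have [M Ms] := sf N; have [M' Mt] := tg N.
by exists (maxn M M') => n; rewrite geq_max => /andP[? ?]; apply: eqXM; auto.
Qed.

Lemma cvg_sum m (s : nat -> nat -> fps) (f : nat -> fps) :
  (forall j, (j < m)%N -> cvg_fps (s j) (f j)) ->
  cvg_fps (fun n => \sum_(j < m) s j n) (\sum_(j < m) f j).
Proof.
elim: m => [|m IH] sf.
  by rewrite big_ord0; apply: cvg_ext (cvg_const _) => n; rewrite big_ord0.
rewrite big_ord_recr /=.
apply: cvg_ext (cvgD (IH _) (sf m _)) => // [n|j jm]; last by apply: sf; lia.
by rewrite big_ord_recr.
Qed.

Lemma cvg_prod m (s : nat -> nat -> fps) (f : nat -> fps) :
  (forall j, (j < m)%N -> cvg_fps (s j) (f j)) ->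
  cvg_fps (fun n => \prod_(j < m) s j n) (\prod_(j < m) f j).
Proof.
elim: m => [|m IH] sf.
  by rewrite big_ord0; apply: cvg_ext (cvg_const _) => n; rewrite big_ord0.
rewrite big_ord_recr /=.
apply: cvg_ext (cvgM (IH _) (sf m _)) => // [n|j jm]; last by apply: sf; lia.
by rewrite big_ord_recr.
Qed.

Lemma cvg_sub (h : nat -> nat) s (f : fps) : (forall n, (n <= h n)%N) ->
  cvg_fps s f -> cvg_fps (fun n => s (h n)) f.
Proof.
move=> hP sf N; have [M Ms] := sf N; exists M => n Mn.
by apply: Ms; apply: leq_trans (hP n).
Qed.

Lemma cvg_uniq s (f g : fps) : cvg_fps s f -> cvg_fps s g -> f = g.
Proof.
move=> sf sg; apply: eqXP => N; have [M Ms] := sf N; have [M' Mt] := sg N.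
have := Ms (maxn M M') (leq_maxl _ _) => /eqX_sym /eqX_trans; apply.
exact: Mt (leq_maxr _ _).
Qed.

Lemma cvg_lim_eqX N s t (f g : fps) : cvg_fps s f -> cvg_fps t g ->
  (forall n, eqX N (s n) (t n)) -> eqX N f g.
Proof.
move=> sf tg st; have [M Ms] := sf N; have [M' Mt] := tg N.
have := Ms (maxn M M') (leq_maxl _ _) => /eqX_sym /eqX_trans; apply.
apply: eqX_trans (st _) _; exact: Mt (leq_maxr _ _).
Qed.

(** The inverse is the geometric series in [1 - f], whose powers tend to 0 because its constant term
    vanishes. *)
Lemma fps_unit (f : fps) : f 0%N = 1 -> f \is a GRing.unit.
Proof.
move=> f0; pose s n := \sum_(i < n) (1 - f) ^+ i.
have h0 : (1 - f) 0%N = 0 by rewrite fcoefD fcoefN f0.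
have /lim_fpsP sP n : eqX n (s n) (s n.+1).
  rewrite /s big_ord_recr /= -[X in eqX _ X _]addr0.
  by apply: eqXD => //; apply/eqX_sym/eqX_exp0.
suff sf : lim_fps s * f = 1.
  by apply/unitrP; exists (lim_fps s); split; last rewrite mulrC.
apply: cvg_uniq (cvgM sP (cvg_const f)) _; apply: cvg_eqX => n.
have -> : s n * f = 1 - (1 - f) ^+ n.
  have := subrX1 (1 - f) n; rewrite -/(s n) => /(congr1 -%R) e.
  rewrite mulrC -[LHS]opprK -[RHS]opprK !opprB.
  rewrite opprB addrAC subrr add0r mulNr opprK in e.
  by rewrite -e opprK.
rewrite -[X in eqX _ _ X]subr0; apply: eqXD => //.
exact/eqXN/eqX_exp0.
Qed.

(** * Infinite products *)

(** Euclidean division of the index by [d]; it serves the products of [qprod_mod] and the sums of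
    [theta_sum_mod]. *)
Lemma big_ord_mod (R : Type) (idx : R) (op : Monoid.com_law idx) d n
    (F : nat -> R) :
  \big[op/idx]_(k < n * d) F k =
  \big[op/idx]_(j < d) \big[op/idx]_(i < n) F (i * d + j)%N.
Proof.
elim: n => [|n IH].
  by rewrite big_ord0 big1 // => j _; rewrite big_ord0.
rewrite mulSnr big_split_ord /= IH -big_split /=.
by apply: eq_bigr => j _; rewrite big_ord_recr.
Qed.

(** In standard notation this is (-e q^r; q^M)_n. *)
Definition qprod_trunc (e : fps) (r M n : nat) : fps :=
  \prod_(i < n) (1 + e * X ^+ (r + i * M)).

Definition qprod (e : fps) (r M : nat) : fps := lim_fps (qprod_trunc e r M).

Lemma qprod_eqX e r M n : (0 < M)%N ->
  eqX n (qprod_trunc e r M n) (qprod e r M).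
Proof.
move=> M0; apply: lim_eqX => {}n; rewrite /qprod_trunc big_ord_recr /=.
rewrite -[X in eqX _ X _]mulr1; apply: eqXM => //.
rewrite -[X in eqX _ X _]addr0; apply: eqXD => //.
rewrite mulrC; apply/eqX_sym/eqX_XnM; nia.
Qed.

Lemma qprod_cvg e r M : (0 < M)%N ->
  cvg_fps (qprod_trunc e r M) (qprod e r M).
Proof. by move=> M0; apply: cvg_eqX => n; apply: qprod_eqX. Qed.

Lemma coef0_qprod e r M : (0 < r)%N -> qprod e r M 0%N = 1.
Proof.
move=> r0; rewrite /qprod /lim_fps /qprod_trunc big_ord1 mulrC fcoefD fcoefXM.
by rewrite ifT ?addr0 //; lia.
Qed.

Lemma qprod_unit e r M : (0 < r)%N -> qprod e r M \is a GRing.unit.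
Proof. by move=> r0; apply/fps_unit/coef0_qprod. Qed.

Lemma qprod_shift e r M : (0 < M)%N ->
  qprod e r M = (1 + e * X ^+ r) * qprod e (r + M) M.
Proof.
move=> M0; apply: cvg_uniq (cvg_sub (h := succn) _ (qprod_cvg e r M0)) _ => //.
apply: cvg_ext (cvgM (cvg_const _) (qprod_cvg _ _ M0)) => n.
rewrite /qprod_trunc big_ord_recl mul0n addn0; congr (_ * _).
by apply: eq_bigr => i _; rewrite -addnA.
Qed.

Lemma qprod_mod d e r M : (0 < d)%N -> (0 < M)%N ->
  \prod_(j < d) qprod e (r + j * M) (d * M) = qprod e r M.
Proof.
move=> d0 M0; have dM : (0 < d * M)%N by rewrite muln_gt0 d0.
apply: cvg_uniq (cvg_prod (fun j _ => qprod_cvg e (r + j * M) dM)) _.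
have hd n : (n <= n * d)%N by rewrite leq_pmulr.
apply: cvg_ext (cvg_sub hd (qprod_cvg e r M0)) => n; rewrite /qprod_trunc.
rewrite (big_ord_mod _ _ _ (fun i => 1 + e * X ^+ (r + i * M))).
apply: eq_bigr => j _; apply: eq_bigr => i _.
by congr (_ + _ * _ ^+ _); ring.
Qed.

Lemma qprod_pm r M : (0 < M)%N ->
  qprod 1 r M * qprod (-1) r M = qprod (-1) (2 * r) (2 * M).
Proof.
move=> M0; have M20 : (0 < 2 * M)%N by lia.
apply: cvg_uniq (cvgM (qprod_cvg _ _ M0) (qprod_cvg _ _ M0)) _.
apply: cvg_ext (qprod_cvg _ _ M20) => n.
rewrite /qprod_trunc -big_split /=; apply: eq_bigr => i _.
have -> : (2 * r + i * (2 * M) = (r + i * M) * 2)%N by ring.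
rewrite exprM; ring.
Qed.

(** * Jacobi's triple product *)

Lemma binD2 m n : 'C(m + n, 2) = ('C(m, 2) + 'C(n, 2) + m * n)%N.
Proof.
elim: m => [|m IH]; first by rewrite bin0n add0n mul0n addn0.
by rewrite addSn !binS !bin1 IH; ring.
Qed.

Lemma bin2_double n : ('C(n, 2) + 'C(n, 2) + n = n * n)%N.
Proof. by elim: n => // n IH; rewrite binS bin1; nia. Qed.

(** * Gaussian binomial coefficients and the finite q-binomial theorem *)

Section QBinomial.
Variables (R : comNzRingType) (Q : R).

(** Gaussian binomials by the q-Pascal rule, which needs no division. *)
Fixpoint gauss m k : R :=
  match m, k with
  | _, 0%N => 1
  | 0%N, _.+1 => 0
  | m'.+1, k'.+1 => gauss m' k' + Q ^+ k'.+1 * gauss m' k'.+1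
  end.

Lemma gauss0 m : gauss m 0 = 1. Proof. by case: m. Qed.

Lemma gauss_small m k : (m < k)%N -> gauss m k = 0.
Proof.
elim: m k => [|m IH] [|k] //= mk; rewrite !IH ?mulr0 ?addr0 //; lia.
Qed.

Lemma gauss_diag m : gauss m m = 1.
Proof. by elim: m => //= m ->; rewrite gauss_small ?mulr0 ?addr0. Qed.

Definition qfact n : R := \prod_(i < n) (1 - Q ^+ i.+1).

(** The quotient formula, cleared of denominators. The Pascal rule combines the cases (j, l+1) and
    (j+1, l) through 1 - Q^(j+l+2) = (1 - Q^(j+1)) + Q^(j+1) (1 - Q^(l+1)), hence the induction on
    [j + l]. *)
Lemma gauss_qfact j l : gauss (j + l) j * (qfact j * qfact l) = qfact (j + l).
Proof.
have [s] := ubnP (j + l); elim: s j l => // s IH [|j] [|l] lts.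
- by rewrite gauss0 /qfact big_ord0 !mul1r.
- by rewrite gauss0 /qfact big_ord0 !mul1r.
- by rewrite addn0 gauss_diag /qfact big_ord0 mul1r mulr1.
have qS n : qfact n.+1 = qfact n * (1 - Q ^+ n.+1) by rewrite /qfact big_ord_recr.
have h1 := IH j l.+1 ltac:(lia); have h2 := IH j.+1 l ltac:(lia).
have -> : gauss (j.+1 + l.+1) j.+1 =
    gauss (j + l.+1) j + Q ^+ j.+1 * gauss (j.+1 + l) j.+1.
  by rewrite [in RHS]addSnnS.
rewrite addSnnS in h2.
have -> : qfact (j.+1 + l.+1) =
    (1 - Q ^+ j.+1) * qfact (j + l.+1) +
    Q ^+ j.+1 * (1 - Q ^+ l.+1) * qfact (j + l.+1).
  by rewrite addSn qS -addSn exprD; ring.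
rewrite -{1}h1 -h2 !qS addSnnS; ring.
Qed.

(** Peeling off the factor [i = 0] replaces [z] by [z * Q]. The homogeneous variable [u] will
    receive a power of [X], which avoids the negative exponents of the usual proof of the triple
    product. *)
Lemma gauss_binomial m (u z : R) :
  \prod_(i < m) (u + z * Q ^+ i) =
  \sum_(k < m.+1) gauss m k * Q ^+ 'C(k, 2) * z ^+ k * u ^+ (m - k).
Proof.
elim: m z => [|m IH] z; first by rewrite big_ord0 big_ord1 /= !mulr1.
rewrite big_ord_recl expr0 mulr1.
under eq_bigr => i _ do rewrite /bump /= exprD expr1 mulrA.
rewrite IH mulrDl addrC [in RHS]big_ord_recl /=.
pose T k := gauss m k * Q ^+ 'C(k, 2) * (z * Q) ^+ k * u ^+ (m.+1 - k).
have -> : u * (\sum_(k < m.+1) gauss m k * Q ^+ 'C(k, 2) * (z * Q) ^+ k *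
    u ^+ (m - k)) = T 0%N + \sum_(k < m.+1) T k.+1.
  rewrite -(big_ord_recl _ (fun k : 'I__ => T k)) [in RHS]big_ord_recr /=.
  rewrite [T m.+1]/T gauss_small // !mul0r addr0 mulr_sumr; apply: eq_bigr => k _.
  by rewrite /T subSn -1?ltnS // exprS; ring.
rewrite addrCA; congr (_ + _); first by rewrite /T gauss0 bin0n; ring.
rewrite mulr_sumr -big_split; apply: eq_bigr => k _.
rewrite /= /bump /= add1n /T subSS binS bin1 !exprS !exprD !exprMn; ring.
Qed.

End QBinomial.

Lemma prod_expr_mul (R : comNzRingType) (x : R) M n :
  \prod_(i < n) x ^+ (M * i) = x ^+ (M * 'C(n, 2)).
Proof.
elim: n => [|n IH]; first by rewrite big_ord0 bin0n muln0.
by rewrite big_ord_recr /= IH -exprD binS bin1 mulnDr.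
Qed.

Definition theta_sum_trunc (e : fps) (r M n : nat) : fps :=
  \sum_(k < n) e ^+ k * X ^+ (M * 'C(k, 2) + r * k).

Definition theta_sum (e : fps) (r M : nat) : fps :=
  lim_fps (theta_sum_trunc e r M).

(** For e^2 = 1 this is the sum over all integers k of e^k q^(M k(k-1)/2 + r k): replacing k by -k
    turns r into M - r, and the subtracted 1 is the doubly counted term k = 0. *)
Definition theta (e : fps) (r M : nat) : fps :=
  theta_sum e r M + theta_sum e (M - r) M - 1.

Lemma theta_sum_cvg e r M : (0 < r)%N ->
  cvg_fps (theta_sum_trunc e r M) (theta_sum e r M).
Proof.
move=> r0; apply: lim_fpsP => n; rewrite /theta_sum_trunc big_ord_recr /=.
rewrite -[X in eqX _ X _]addr0; apply: eqXD => //.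
rewrite mulrC; apply/eqX_sym/eqX_XnM; nia.
Qed.

Section TripleProduct.
Variables (e : fps) (r M : nat).
Hypotheses (e2 : e * e = 1) (r0 : (0 < r)%N) (rM : (r < M)%N).

(** The term of index k - n of the bilateral series [theta e r M]. *)
Let T n k : fps := if (n <= k)%N
  then e ^+ (k - n) * X ^+ (M * 'C(k - n, 2) + r * (k - n))
  else e ^+ (n - k) * X ^+ (M * 'C(n - k, 2) + (M - r) * (n - k)).

Let e2n n : e ^+ n * e ^+ n = 1.
Proof. by rewrite -exprMn e2 expr1n. Qed.

(* The binomial theorem for prod_(i < 2n) (u + e Q^i) with Q = X^M and
   u = X^(nM - r), after extraction of a power of X from every factor. *)
Lemma triple_product_trunc n : (0 < n)%N ->
  qprod_trunc e r M n * qprod_trunc e (M - r) M n =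
  \sum_(k < (n + n).+1) gauss (X ^+ M) (n + n) k * T n k.
Proof.
move=> n0; have [s Ms s0] : exists2 s, M = (r + s)%N & (0 < s)%N.
  by exists (M - r)%N; lia.
have [m nm] : exists m, n = m.+1 by exists n.-1; lia.
have [A AE] : exists A, A = (n * (m * M + s) + M * 'C(n, 2))%N by eexists.
have wr : (m * M + s + r = n * M)%N by rewrite nm Ms; ring.
have [w wE] : exists w, w = (m * M + s)%N by eexists.
(* For [i < n] the second summand has the smaller exponent: X^w + e X^(Mi) = e X^(Mi) (1 + e X^(w -
   Mi)), with the factors in reverse order. In [high] it is X^w that comes out. *)
have low : \prod_(i < n) (X ^+ w + e * (X ^+ M) ^+ i) =
    e ^+ n * X ^+ (M * 'C(n, 2)) * qprod_trunc e (M - r) M n.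
  have -> : e ^+ n = \prod_(i < n) e by rewrite prodr_const card_ord.
  have -> : qprod_trunc e (M - r) M n =
      \prod_(i < n) (1 + e * X ^+ (M - r + (n - i.+1) * M)).
    by rewrite /qprod_trunc (reindex_inj rev_ord_inj).
  rewrite -prod_expr_mul -!big_split; apply: eq_bigr => i _ /=.
  have -> : X ^+ w = X ^+ (M * i) * X ^+ (M - r + (n - i.+1) * M).
    rewrite -exprD; congr (_ ^+ _).
    have [l [ml nl]] : exists l, m = (i + l)%N /\ (n - i.+1 = l)%N.
      by exists (m - i)%N; have := ltn_ord i; lia.
    by rewrite nl wE ml Ms addKn; ring.
  rewrite mulrDr mulr1 addrC -exprM; congr (_ + _).
  transitivity (e * e * X ^+ (M * i) * X ^+ (M - r + (n - i.+1) * M)); last by ring.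
  by rewrite e2 mul1r.
have high : \prod_(i < n) (X ^+ w + e * (X ^+ M) ^+ (n + i)) =
    X ^+ (n * w) * qprod_trunc e r M n.
  have -> : X ^+ (n * w) = \prod_(i < n) X ^+ w.
    by rewrite prodr_const card_ord -exprM mulnC.
  rewrite -big_split; apply: eq_bigr => i _ /=.
  rewrite -exprM mulrDr mulr1 mulrCA -exprD; congr (_ + _ * _ ^+ _).
  by rewrite wE; nia.
(* [A] is the total exponent extracted in [low] and [high]; one factor of the inserted square of
   [e ^+ n] matches the sign left by [low]. *)
apply: (@mulXn_inj A); rewrite -[LHS]mul1r -[RHS]mul1r -(e2n n) -!mulrA.
congr (_ * _).
transitivity (\prod_(i < n + n) (X ^+ w + e * (X ^+ M) ^+ i)).
  by rewrite big_split_ord /= low high AE -wE exprD; ring.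
rewrite gauss_binomial !mulr_sumr; apply: eq_bigr => k _.
suff h : e ^+ n * (X ^+ A * T n k) =
    X ^+ (M * 'C(k, 2)) * e ^+ k * X ^+ (w * (n + n - k)).
  by rewrite [X ^+ A * _]mulrCA [RHS]mulrCA h -!exprM; ring.
rewrite /T; move: (nat_of_ord k) (ltn_ord k) => {}k kn; case: leqP => nk.
  have [j [l [kE nE]]] : exists j l, k = (n + j)%N /\ n = (j + l)%N.
    by exists (k - n)%N, (n + n - k)%N; lia.
  have -> : (k - n = j)%N by lia.
  have -> : (n + n - k = l)%N by lia.
  have E : (A + (M * 'C(j, 2) + r * j) = M * 'C(k, 2) + w * l)%N.
    rewrite kE binD2 AE -wE; nia.
  transitivity (e ^+ (n + j) * X ^+ (A + (M * 'C(j, 2) + r * j))).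
    by rewrite (exprD _ A) [e ^+ (_ + _)]exprD; ring.
  by rewrite E (exprD X) mulrCA mulrA kE.
have [j [nE kE]] : exists j, n = (k + j)%N /\ (n + n - k = n + j)%N.
  by exists (n - k)%N; lia.
have -> : (n - k = j)%N by lia.
have E : (A + (M * 'C(j, 2) + (M - r) * j) = M * 'C(k, 2) + w * (n + j))%N.
  have jj := bin2_double j; have M's : (M - r = s)%N by lia.
  rewrite AE -wE M's nE binD2.
  have e1 := congr1 (muln^~ j) wr; have e2' := congr1 (muln M) jj.
  by rewrite nE Ms in e1 e2' *; nia.
rewrite kE; transitivity (e ^+ n * e ^+ j * X ^+ (A + (M * 'C(j, 2) + (M - r) * j))).
  by rewrite (exprD _ A); ring.
rewrite E {1}nE exprD -[_ * _ * e ^+ j]mulrA e2n mulr1.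
by rewrite (exprD X); ring.
Qed.

Lemma sum_triple n : \sum_(k < (n + n).+1) T n k =
  theta_sum_trunc e r M n.+1 + theta_sum_trunc e (M - r) M n.+1 - 1.
Proof.
rewrite -addnS big_split_ord [LHS]addrC /= -[RHS]addrA; congr (_ + _).
  apply: eq_bigr => k _; rewrite /T leq_addr addnC addnK; congr (_ * _ ^+ _).
rewrite /theta_sum_trunc big_ord_recl bin0n !muln0 !expr0 mulr1.
rewrite addrAC subrr add0r (reindex_inj rev_ord_inj) /=.
apply: eq_bigr => k _; have := ltn_ord k => kn.
by rewrite /T ifF /bump /=; [rewrite add1n subKn | lia].
Qed.

(** Letting n grow in [triple_product_trunc], each Gaussian coefficient near the middle tends to 1 /
    (q^M; q^M)_infinity, and the terms far from the middle have high order. *)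
Theorem triple_product :
  theta e r M = qprod (-1) M M * (qprod e r M * qprod e (M - r) M).
Proof.
have M0 : (0 < M)%N by lia.
have MM0 : qprod (-1) M M \is a GRing.unit by apply: qprod_unit.
pose s n := qprod (-1) M M * (qprod_trunc e r M n * qprod_trunc e (M - r) M n).
have sP : cvg_fps s (qprod (-1) M M * (qprod e r M * qprod e (M - r) M)).
  by apply: cvgM (cvg_const _) (cvgM _ _); apply: qprod_cvg.
apply: cvg_uniq _ sP => N.
pose t n := theta_sum_trunc e r M n.+1 + theta_sum_trunc e (M - r) M n.+1 - 1.
have tP : cvg_fps t (theta e r M).
  apply: cvgD (cvgD _ _) (cvg_const _).
    by apply: (cvg_sub (h := succn)) => //; apply: theta_sum_cvg.
  by apply: (cvg_sub (h := succn)) => //; apply: theta_sum_cvg; lia.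
have [K tK] := tP N; exists (K + (N + N).+1)%N => n Kn.
apply: eqX_trans (tK n _); last by lia.
rewrite /s triple_product_trunc; last by lia.
rewrite /t -sum_triple mulr_sumr; apply: eqX_sum => k _.
rewrite mulrA -[X in eqX _ _ X]mul1r.
have kn : (k < (n + n).+1)%N := ltn_ord k.
(* Terms at distance at least [N] from the middle vanish modulo X^N, since [r] and [M - r] are
   positive. *)
have [far|near] := boolP ((k + N <= n) || (n + N <= k))%N.
  apply: (@eqX_trans _ _ 0); last apply: eqX_sym.
    by rewrite mulrC; apply: eqX_mul0; rewrite /T; case: ifP => nk;
      rewrite mulrC; apply: eqX_XnM; nia.
  by rewrite mul1r /T; case: ifP => nk; rewrite mulrC; apply: eqX_XnM; nia.
apply: eqXM => //.
(* Here [k], [2n - k] and [2n] are all at least [N], so the three q-factorials agree modulo X^N with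
   the infinite product. *)
have := @gauss_qfact _ (X ^+ M) k (n + n - k).
have qE m : qfact (X ^+ M) m = qprod_trunc (-1) M M m.
  apply: eq_bigr => i _; rewrite -exprM mulN1r; congr (1 - _ ^+ _).
  by rewrite mulnS mulnC.
have qQ m : (N <= m)%N -> eqX N (qfact (X ^+ M) m) (qprod (-1) M M).
  by move=> Nm; rewrite qE; apply: (eqX_leq Nm); apply: qprod_eqX.
rewrite subnKC; last by lia.
move: (gauss _ _ _) => g gq.
have gQ : eqX N (g * (qprod (-1) M M * qprod (-1) M M)) (qprod (-1) M M).
  apply: (@eqX_trans _ _ (qfact (X ^+ M) (n + n))); last by apply: qQ; lia.
  by rewrite -gq; apply: eqXM => //; apply: eqX_sym; apply: eqXM; apply: qQ; lia.
have := eqXM gQ (eqX_refl (qprod (-1) M M)^-1).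
by rewrite divrr // mulrA mulrK // mulrC.
Qed.

End TripleProduct.

(** * The even part of B as a bilateral sum *)

Lemma eqXV N (f g : fps) : f \is a GRing.unit -> g \is a GRing.unit ->
  eqX N f g -> eqX N f^-1 g^-1.
Proof.
move=> uf ug fg; have -> : f^-1 = f^-1 * (g * g^-1) by rewrite divrr ?mulr1.
rewrite mulrA -[X in eqX _ _ X]mul1r; apply: eqXM => //.
by rewrite -(mulVr uf); apply: eqXM => //; apply: eqX_sym.
Qed.

Lemma fcoefM0 (f g : fps) : (f * g) 0%N = f 0%N * g 0%N.
Proof. exact: big_ord1. Qed.

Lemma eqX_mulS N (f g : fps) : eqX N f 0 -> g 0%N = 0 -> eqX N.+1 (f * g) 0.
Proof.
move=> f0 g0 i iN; rewrite [LHS]big_ord_recr /= subnn g0 mulr0 addr0.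
by rewrite big1 // => j _; rewrite f0 ?mul0r //; have := ltn_ord j; lia.
Qed.

Lemma eqX_prod0 n (F : nat -> fps) : (forall i, F i 0%N = 0) ->
  eqX n (\prod_(i < n) F i) 0.
Proof.
move=> F0; elim: n => // n IH; rewrite big_ord_recr; exact: eqX_mulS.
Qed.

Lemma unit_1DX (c : fps) k : (0 < k)%N -> 1 + c * X ^+ k \is a GRing.unit.
Proof.
by move=> k0; apply: fps_unit; rewrite mulrC fcoefD fcoefXM k0 addr0.
Qed.

Lemma qprod_trunc_unit e r M n : (0 < r)%N ->
  qprod_trunc e r M n \is a GRing.unit.
Proof. by move=> r0; apply: rpred_prod => i _; apply: unit_1DX; lia. Qed.

Lemma qprod_truncS e r M n :
  qprod_trunc e r M n.+1 = qprod_trunc e r M n * (1 + e * X ^+ (r + n * M)).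
Proof. by rewrite /qprod_trunc big_ord_recr. Qed.

Lemma divr_mulK (R : comUnitRingType) (x d f : R) :
  d \is a GRing.unit -> f \is a GRing.unit -> x / (d * f) * f = x / d.
Proof. by move=> ud uf; rewrite invrM // [_ / d]mulrC mulrA divrK. Qed.

(* [psi11 y] is Ramanujan's bilateral series 1psi1(-q; y q^2; q^2, q), with the
   terms of negative index cleared of negative powers of [q]. *)
Definition den (y : fps) n : fps := \prod_(j < n) (1 + (- y) * X ^+ (2 + j * 2)).
Definition psi_pos (y : fps) n : fps := X ^+ n * qprod_trunc 1 1 2 n / den y n.
Definition psi_neg (y : fps) n : fps :=
  (\prod_(j < n) (X ^+ (j * 2) - y)) / qprod_trunc 1 1 2 n.
Definition psi_trunc (y : fps) n : fps :=
  \sum_(i < n) psi_pos y i + \sum_(i < n) psi_neg y i.+1.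
Definition psi11 (y : fps) : fps := lim_fps (psi_trunc y).

Lemma den_unit y n : den y n \is a GRing.unit.
Proof. by apply: rpred_prod => j _; apply: unit_1DX. Qed.

Lemma denS y n : den y n.+1 = den y n * (1 + (- y) * X ^+ (2 + n * 2)).
Proof. by rewrite /den big_ord_recr. Qed.

Lemma den_shift y n : den y n.+1 = (1 - y * X ^+ 2) * den (y * X ^+ 2) n.
Proof.
rewrite /den big_ord_recl mulNr; congr (_ * _); apply: eq_bigr => j _.
by rewrite !mulNr -mulrA -exprD.
Qed.

(* The difference of the two sides telescopes, term by term. *)
Lemma psi_trunc_shift y n :
  (1 - y * X ^+ 2) * (1 + y) * psi_trunc y n
  = (1 + y * X) * psi_trunc (y * X ^+ 2) n
    + y * (1 - y * X ^+ 2) * (psi_neg y n - psi_pos y n).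
Proof.
elim: n => [|n IH].
  rewrite /psi_trunc /psi_neg /psi_pos /den /qprod_trunc !big_ord0 expr0; ring.
have tS z : psi_trunc z n.+1 = psi_trunc z n + (psi_pos z n + psi_neg z n.+1).
  by rewrite /psi_trunc !big_ord_recr /=; ring.
rewrite !tS mulrDr IH [in RHS]mulrDr -[LHS]addrA -[RHS]addrA; congr (_ + _).
(* Every term involved is a polynomial multiple of [W] (nonnegative index) or of [V] (negative
   index), which reduces the step to a ring identity. *)
pose W := X ^+ n * qprod_trunc 1 1 2 n / den y n.+1.
have pos_n : psi_pos y n = W * (1 - y * X ^+ (2 + n * 2)).
  by rewrite /W denS -mulNr divr_mulK ?den_unit ?unit_1DX.
have pos_nS : psi_pos y n.+1 = W * X * (1 + X ^+ (1 + n * 2)).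
  rewrite /W /psi_pos qprod_truncS exprS mul1r; ring.
have pos_sh : psi_pos (y * X ^+ 2) n = (1 - y * X ^+ 2) * W.
  have u1 : 1 - y * X ^+ 2 \is a GRing.unit by rewrite -mulNr unit_1DX.
  by rewrite [RHS]mulrC /W den_shift [_ * den _ _]mulrC divr_mulK ?den_unit.
pose V := (\prod_(j < n) (X ^+ (j * 2) - y)) / qprod_trunc 1 1 2 n.+1.
have neg_n : psi_neg y n = V * (1 + X ^+ (1 + n * 2)).
  rewrite -[X ^+ (1 + _)]mul1r /V qprod_truncS.
  by rewrite divr_mulK ?qprod_trunc_unit ?unit_1DX.
have neg_nS : psi_neg y n.+1 = V * (X ^+ (n * 2) - y).
  by rewrite /psi_neg big_ord_recr /V /=; ring.
have neg_sh : psi_neg (y * X ^+ 2) n.+1 = (1 - y * X ^+ 2) * X ^+ (n * 2) * V.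
  rewrite /psi_neg /V [RHS]mulrA; congr (_ * _); rewrite big_ord_recl /= -mulrA.
  congr (_ * _); have -> : X ^+ (n * 2) = \prod_(j < n) X ^+ 2.
    by rewrite prodr_const card_ord -exprM mulnC.
  rewrite -big_split; apply: eq_bigr => j _ /=.
  by rewrite /bump /= mulnDl exprD mulrBr [y * _]mulrC.
rewrite pos_n pos_nS pos_sh neg_n neg_nS neg_sh !exprD; ring.
Qed.

(** Terms of negative index carry no growing power of [X] by themselves, so convergence is a
    condition on [y]. It holds when [y] has zero constant term, and at [y = 1], where these terms
    vanish. *)
Definition psi_summable (y : fps) := forall n, eqX n (psi_neg y n.+1) 0.

Lemma psi_summable0 (y : fps) : y 0%N = 0 -> psi_summable y.
Proof.
move=> y0 n; apply: eqX_mul0; rewrite big_ord_recl mulrC; apply: eqX_mul0.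
by apply: (@eqX_prod0 n (fun j => X ^+ (j.+1 * 2) - y)) => j;
  rewrite fcoefD fcoefN fcoefX y0.
Qed.

Lemma psi_neg1 n : psi_neg 1 n.+1 = 0.
Proof. by rewrite /psi_neg big_ord_recl /= subrr !mul0r. Qed.

Lemma psi_summable1 : psi_summable 1.
Proof. by move=> n; rewrite psi_neg1. Qed.

Lemma psi_cvg y : psi_summable y -> cvg_fps (psi_trunc y) (psi11 y).
Proof.
move=> ys; apply: lim_fpsP => n; rewrite /psi_trunc !big_ord_recr /=.
rewrite -[X in eqX _ (X + _)]addr0 -[X in eqX _ (_ + X)]addr0.
apply: eqXD; apply: eqXD => //; apply: eqX_sym; last exact: ys.
by rewrite /psi_pos -mulrA; apply: eqX_XnM.
Qed.

Lemma psi_pos_cvg0 y : cvg_fps (psi_pos y) 0.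
Proof. by apply: cvg_eqX => n; rewrite /psi_pos -mulrA; apply: eqX_XnM. Qed.

Lemma psi_neg_cvg0 y : psi_summable y -> cvg_fps (psi_neg y) 0.
Proof.
by move=> ys N; exists N.+1 => -[//|n]; rewrite ltnS => Nn; apply: eqX_leq (ys n).
Qed.

(** The boundary terms [psi_neg y n] and [psi_pos y n] left by telescoping tend to 0. *)
Lemma psi11_shift y : psi_summable y ->
  (1 - y * X ^+ 2) * (1 + y) * psi11 y = (1 + y * X) * psi11 (y * X ^+ 2).
Proof.
move=> ys; have ys2 : psi_summable (y * X ^+ 2).
  by apply: psi_summable0; rewrite mulrC fcoefXM.
apply: cvg_uniq (cvgM (cvg_const _) (psi_cvg ys)) _.
have -> : (1 + y * X) * psi11 (y * X ^+ 2) =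
    (1 + y * X) * psi11 (y * X ^+ 2) + y * (1 - y * X ^+ 2) * (0 - 0) by ring.
apply: cvg_ext (cvgD (cvgM (cvg_const (1 + y * X)) (psi_cvg ys2))
  (cvgM (cvg_const (y * (1 - y * X ^+ 2)))
     (cvgD (psi_neg_cvg0 ys) (cvgN (psi_pos_cvg0 y))))) => n.
by rewrite psi_trunc_shift.
Qed.

Lemma psi11_eqX0 N y : psi_summable y -> eqX N y 0 -> eqX N (psi11 y) (psi11 0).
Proof.
move=> ys y0; have s0 : psi_summable 0 by apply: psi_summable0.
apply: cvg_lim_eqX (psi_cvg ys) (psi_cvg s0) _ => n.
apply: eqXD; apply: eqX_sum => i _; apply: eqXM => //.
  apply: eqXV; rewrite ?den_unit //; apply: eqX_prod => j _.
  by apply: eqXD => //; apply: eqXM => //; apply: eqXN.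
by apply: eqX_prod => j _; apply: eqXD => //; apply: eqXN.
Qed.

Lemma psi_summableX m : psi_summable (X ^+ m).
Proof.
case: m => [|m]; first by rewrite expr0; apply: psi_summable1.
by apply: psi_summable0; rewrite fcoefX.
Qed.

Lemma psi11_iter m n :
  qprod_trunc (-1) (m + 2) 2 n * qprod_trunc 1 m 2 n * psi11 (X ^+ m) =
  qprod_trunc 1 (m + 1) 2 n * psi11 (X ^+ (m + n * 2)).
Proof.
elim: n => [|n IH]; first by rewrite /qprod_trunc !big_ord0 !mul1r addn0.
rewrite !qprod_truncS.
transitivity ((1 - X ^+ (m + n * 2) * X ^+ 2) * (1 + X ^+ (m + n * 2)) *
  (qprod_trunc (-1) (m + 2) 2 n * qprod_trunc 1 m 2 n * psi11 (X ^+ m))).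
  by rewrite !exprD; ring.
rewrite IH mulrCA psi11_shift; last exact: psi_summableX.
by rewrite -exprD -addnA -mulSnr !exprD; ring.
Qed.

(** Each use of [psi11_shift] multiplies y by q^2, so y = q^m is driven to 0; the only unknown left
    is the constant [psi11 0]. *)
Lemma psi11_prod m :
  qprod (-1) (m + 2) 2 * qprod 1 m 2 * psi11 (X ^+ m) =
  qprod 1 (m + 1) 2 * psi11 0.
Proof.
apply: cvg_uniq (cvgM (cvgM (qprod_cvg _ _ _) (qprod_cvg _ _ _)) (cvg_const _)) _ => //.
have lim0 : cvg_fps (fun n => psi11 (X ^+ (m + n * 2))) (psi11 0).
  apply: cvg_eqX => n; apply: psi11_eqX0; first exact: psi_summableX.
  by apply: eqX_Xn; lia.
by apply: cvg_ext (cvgM (qprod_cvg _ _ _) lim0) => // n; rewrite psi11_iter.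
Qed.

(** The series of the q-binomial theorem at base q^2: its terms are (-q; q^2)_n z^n / (q^2;
    q^2)_n. *)
Definition binom_term (z : fps) n : fps := z ^+ n * qprod_trunc 1 1 2 n / den 1 n.
Definition binom_trunc z n : fps := \sum_(i < n) binom_term z i.
Definition binom_series z : fps := lim_fps (binom_trunc z).

Lemma binom_trunc_shift z n :
  (1 - z) * binom_trunc z n =
  (1 + X * z) * binom_trunc (z * X ^+ 2) n - binom_term z n * (1 - X ^+ (n * 2)).
Proof.
elim: n => [|n IH]; first by rewrite /binom_trunc !big_ord0; ring.
rewrite /binom_trunc !big_ord_recr /= -!/(binom_trunc _ _).
rewrite mulrDr IH.
have -> : binom_term z n.+1 * (1 - X ^+ (n.+1 * 2)) =
    binom_term z n * z * (1 + X ^+ (1 + n * 2)).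
  rewrite mulSn -mulN1r /binom_term denS divr_mulK ?den_unit ?unit_1DX //.
  by rewrite qprod_truncS exprS mul1r; ring.
have -> : binom_term (z * X ^+ 2) n = X ^+ (n * 2) * binom_term z n.
  by rewrite /binom_term exprMn -exprM [(2 * n)%N]mulnC; ring.
rewrite exprD; ring.
Qed.

Lemma binom_cvg (z : fps) : z 0%N = 0 ->
  cvg_fps (binom_trunc z) (binom_series z).
Proof.
move=> z0; apply: lim_fpsP => n; rewrite /binom_trunc big_ord_recr /=.
rewrite -[X in eqX _ X]addr0; apply: eqXD => //; apply: eqX_sym.
by rewrite /binom_term -mulrA; apply/eqX_mul0/eqX_exp0.
Qed.

Lemma binom_shift (z : fps) : z 0%N = 0 ->
  (1 - z) * binom_series z = (1 + X * z) * binom_series (z * X ^+ 2).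
Proof.
move=> z0; have z20 : (z * X ^+ 2) 0%N = 0 by rewrite fcoefM0 z0 mul0r.
apply: cvg_uniq (cvgM (cvg_const _) (binom_cvg z0)) _.
have t0 : cvg_fps (fun n => - (binom_term z n * (1 - X ^+ (n * 2)))) (- 0).
  apply/cvgN/cvg_eqX => n; rewrite /binom_term -!mulrA.
  by apply/eqX_mul0/eqX_exp0.
rewrite -[X in cvg_fps _ X]addr0 -oppr0.
apply: cvg_ext (cvgD (cvgM (cvg_const _) (binom_cvg z20)) t0) => n.
by rewrite binom_trunc_shift.
Qed.

Lemma binom_eqX1 m : (0 < m)%N -> eqX m (binom_series (X ^+ m)) 1.
Proof.
move=> m0; have z0 : (X ^+ m) 0%N = 0 by rewrite fcoefX; case: m m0.
apply: cvg_lim_eqX (cvg_sub (h := succn) _ (binom_cvg z0)) (cvg_const 1) _ => // n.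
rewrite /binom_trunc big_ord_recl -[X in eqX _ _ X]addr0; apply: eqXD.
  by rewrite /binom_term /qprod_trunc /den !big_ord0 invr1 !mulr1.
apply: (@eqX_trans _ _ (\sum_(i < n) 0)); last by rewrite big1.
apply: eqX_sum => i _; rewrite /binom_term /= -!mulrA -exprM.
by apply: eqX_XnM; rewrite /bump; nia.
Qed.

(** Iterating [binom_shift] from z = q drives z to 0, where the series is 1. *)
Lemma binom_prod : qprod (-1) 1 2 * binom_series X = qprod 1 2 2.
Proof.
apply: cvg_uniq (cvgM (qprod_cvg _ _ _) (cvg_const _)) _ => //.
have lim1 : cvg_fps (fun n => binom_series (X ^+ (1 + n * 2))) 1.
  apply: cvg_eqX => n; apply: eqX_leq (binom_eqX1 _) => //; lia.
rewrite -[X in cvg_fps _ X]mulr1.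
apply: cvg_ext (cvgM (qprod_cvg _ _ _) lim1) => // n.
elim: n => [|n IH]; first by rewrite /qprod_trunc !big_ord0.
rewrite !qprod_truncS.
transitivity ((1 - X ^+ (1 + n * 2)) * (qprod_trunc (-1) 1 2 n * binom_series X)).
  rewrite -IH [RHS]mulrCA binom_shift ?fcoefX //.
  by rewrite -exprD -addnA -mulSnr !exprD; ring.
by rewrite mulN1r; ring.
Qed.

(** At y = 1 every term of negative index contains a zero factor, so the bilateral series becomes
    one-sided. *)
Lemma psi11_1 : psi11 1 = binom_series X.
Proof.
congr (lim_fps _); apply/funext => n; rewrite /psi_trunc [X in _ + X]big1.
  by rewrite addr0.
by move=> i _; rewrite psi_neg1.
Qed.

(** The cases [m = 0] and [m = 1] of [psi11_prod] share the unknown [psi11 0]: the first evaluates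
    it through [binom_prod], the second then yields [psi11 X]. *)
Lemma psi11_X :
  psi11 X * (qprod (-1) 1 2 * qprod 1 1 2) ^+ 2 =
  (1 - X) * (qprod 1 2 2 ^+ 3 * qprod (-1) 2 2 *+ 2).
Proof.
have := psi11_prod 0; rewrite expr0 psi11_1.
(* The factor of exponent 0 in (-1; q^2)_infinity equals 2, the source of the factor 2 in the
   statement. *)
rewrite [qprod 1 0 2]qprod_shift // expr0 mulr1 => e0.
have e1 := psi11_prod 1; have e2 := binom_prod.
have e3 := @qprod_shift (-1) 1 2 isT.
rewrite expr1 in e1 e3.
rewrite e3; rewrite e3 in e2.
set o := qprod (-1) (1 + 2) 2 in e1 e2 e3 *.
set p := qprod 1 2 2 in e0 e1 e2 *; set f := qprod (-1) _ 2 in e0 *.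
set a := qprod 1 1 2 in e0 e1 e2 *.
transitivity ((1 + -1 * X) ^+ 2 * o * a * (o * a * psi11 X)); first by ring.
rewrite e1.
transitivity ((1 + -1 * X) * p * ((1 + -1 * X) * o) * (a * psi11 0)); first by ring.
rewrite -e0.
transitivity ((1 + -1 * X) * p * f * p * 2%:R * ((1 + -1 * X) * o * binom_series X)).
  ring.
rewrite e2; ring.
Qed.

(** * The series B as a limit, and the substitution of -q for q *)

Lemma fps_prodE (F : nat -> fps) n :
  fps_prod [seq F j | j <- iota 0 n] = \prod_(j < n) F j.
Proof.
rewrite -(big_mkord xpredT F) /index_iota subn0.
by elim: (iota 0 n) => [|k s IH]; rewrite ?big_nil // big_cons /= IH.
Qed.

Lemma fps_binomE k : fps_binom 1 k = 1 + 1 * X ^+ k.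
Proof. by apply/funext => n; rewrite mul1r fcoefD fcoefX /fps_binom mul1r. Qed.

Lemma fps_geomE k : (0 < k)%N -> fps_geom k * (1 + -1 * X ^+ k) = 1.
Proof.
move=> k0; apply/funext => n.
rewrite mulN1r mulrBr mulr1 mulrC fcoefD fcoefN fcoefXM fcoef1 /fps_geom.
have [nk|kn] := ltnP n k.
  rewrite subr0; case: n nk => [|n] nk; first by rewrite dvdn0.
  by rewrite gtnNdvd.
rewrite dvdn_subl // subrr; case: n kn => // kn; lia.
Qed.

Lemma B_termE n :
  B_term n = X ^+ n * (qprod_trunc 1 1 2 n / qprod_trunc (-1) 1 2 n.+1).
Proof.
rewrite /B_term -[fps_mul]/(@GRing.mul fps) fps_XE; congr (_ * (_ * _)).
  rewrite /negq_q2 (fps_prodE (fun j => fps_binom 1 (2 * j).+1)).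
  by apply: eq_bigr => j _; rewrite fps_binomE mulnC add1n.
apply: (mulIr (qprod_trunc_unit (-1) 2 n.+1 (isT : 0 < 1)%N)).
rewrite mulVr ?qprod_trunc_unit // /inv_q_q2.
rewrite (fps_prodE (fun j => fps_geom (2 * j).+1)) -big_split big1 //= => j _.
by rewrite add1n [(j * 2)%N]mulnC fps_geomE.
Qed.

Definition bser : fps := b.

Lemma b_cvg : cvg_fps (fun n => \sum_(i < n) B_term i) bser.
Proof.
(* The cut-off in the definition of [b] is exactly the diagonal taken by [lim_fps]. *)
have -> : bser = lim_fps (fun n => \sum_(i < n) B_term i).
  by apply/funext => n; rewrite /lim_fps fcoef_sum.
apply: lim_fpsP => n; rewrite big_ord_recr /= -[X in eqX _ X]addr0.
by apply: eqXD => //; rewrite B_termE; apply/eqX_sym/eqX_XnM.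
Qed.

Definition twist (f : fps) : fps := fun n => (-1) ^+ n * f n.

Lemma twistD f g : twist (f + g) = twist f + twist g.
Proof. by apply/funext => n; rewrite fcoefD -mulrDr. Qed.

Lemma twistM f g : twist (f * g) = twist f * twist g.
Proof.
apply/funext => n; rewrite /twist !fcoefM mulr_sumr.
apply: eq_bigr => i _; have -> : (-1) ^+ n = (-1) ^+ i * (-1) ^+ (n - i) :> int.
  by rewrite -exprD subnKC //; have := ltn_ord i; lia.
ring.
Qed.

Lemma fcoef_sign k (f : fps) n : ((-1) ^+ k * f) n = (-1) ^+ k * f n.
Proof.
by elim: k => [|k IH]; rewrite ?mul1r // !exprS -!mulrA !mulN1r fcoefN IH.
Qed.

Lemma twistX k : twist (X ^+ k) = (-1) ^+ k * X ^+ k.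
Proof.
apply/funext => n; rewrite fcoef_sign /twist fcoefX.
by case: eqP => [->|]; rewrite ?mulr0.
Qed.

Lemma twist1 : twist 1 = 1.
Proof. by have := twistX 0; rewrite !expr0 mul1r. Qed.

Lemma twistN f : twist (- f) = - twist f.
Proof. by apply/funext => n; rewrite fcoefN -mulrN. Qed.

Lemma twist_div f g : g \is a GRing.unit -> twist g \is a GRing.unit ->
  twist (f / g) = twist f / twist g.
Proof. by move=> ug utg; apply: (mulIr utg); rewrite -twistM !divrK. Qed.

Lemma twist_cvg s f : cvg_fps s f -> cvg_fps (fun n => twist (s n)) (twist f).
Proof.
by move=> sf N; have [M Ms] := sf N; exists M => n /Ms e i iN; rewrite /twist e.
Qed.

Lemma twist_qprod_trunc e e' n : twist e' = - e ->
  twist (qprod_trunc e' 1 2 n) = qprod_trunc e 1 2 n.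
Proof.
move=> ee; rewrite /qprod_trunc (big_morph twist twistM twist1).
apply: eq_bigr => i _; rewrite twistD twist1 twistM ee twistX.
by rewrite -signr_odd oddD oddM andbF expr1; ring.
Qed.

(** At y = q, [den] times 1 - q is (q; q^2)_(n+1), which gives the terms of B. In the term of index
    -(n+1), the factor j = 0 is 1 - q and the others are q^(2j) - q = -q (1 - q^(2j-1)), which gives
    the terms of B(-q). *)
Lemma psi11_X_b : psi11 X = (1 - X) * (bser + twist bser).
Proof.
have sX := psi_summableX 1; rewrite expr1 in sX.
apply: cvg_uniq (psi_cvg sX) _.
apply: cvg_ext (cvgM (cvg_const _) (cvgD b_cvg (twist_cvg b_cvg))) => n.
rewrite (big_morph twist twistD (_ : twist 0 = 0)); last first.
  by apply/funext => k; rewrite /twist mulr0.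
rewrite mulrDr !mulr_sumr; congr (_ + _); apply: eq_bigr => i _.
  have -> : B_term i = X ^+ i * (qprod_trunc 1 1 2 i / (den X i * (1 - X))).
    rewrite B_termE /qprod_trunc [in LHS]big_ord_recl [(1 + _) * _]mulrC mulN1r expr1.
    congr (_ * (_ / (_ * _))).
    by apply: eq_bigr => j _; rewrite mulN1r mulNr -exprS /bump /= mulnDl.
  rewrite [LHS]mulrC -[LHS]mulrA divr_mulK ?den_unit ?mulrA //.
  by rewrite -mulN1r -[X]expr1 unit_1DX.
have t1 : twist (1 : fps) = - (-1) by rewrite twist1 opprK.
have tN1 : twist (-1 : fps) = - 1 by rewrite twistN twist1.
rewrite B_termE twistM twist_div ?qprod_trunc_unit ?(twist_qprod_trunc _ tN1)
  ?(twist_qprod_trunc _ t1) ?qprod_trunc_unit //.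
rewrite /psi_neg twistX !mulrA; congr (_ / _).
rewrite big_ord_recl /= -2!mulrA; congr (_ * _); rewrite mulrA.
have -> : (-1) ^+ i * X ^+ i = \prod_(j < i) (- X).
  by rewrite prodr_const card_ord -exprMn mulN1r.
rewrite -big_split; apply: eq_bigr => j _ /=.
by rewrite /bump /= mulnDl !exprD; ring.
Qed.

(** * Theta functions *)

Notation euler k := (qprod (-1) k k).

Lemma qprod_mod2 e r M : (0 < M)%N ->
  qprod e r (2 * M) * qprod e (r + M) (2 * M) = qprod e r M.
Proof.
move=> M0; have := @qprod_mod 2 e r M isT M0.
by rewrite big_ord_recl big_ord1 /= /bump /= mul0n addn0 addn0 mul1n.
Qed.

Lemma qprod_mod3 e r M : (0 < M)%N ->
  qprod e r (3 * M) * qprod e (r + M) (3 * M) * qprod e (r + 2 * M) (3 * M)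
  = qprod e r M.
Proof.
move=> M0; have := @qprod_mod 3 e r M isT M0.
by rewrite !big_ord_recl big_ord0 /= /bump /= !addn0 mul1n mulr1 mulrA.
Qed.

Lemma euler_odd c : (0 < c)%N ->
  qprod (-1) c (2 * c) * euler (2 * c) = euler c.
Proof. by move=> c0; rewrite -(qprod_mod2 _ c c0) addnn mul2n. Qed.

Lemma euler_neg c : (0 < c)%N -> qprod 1 c c * euler c = euler (2 * c).
Proof. exact: qprod_pm. Qed.

Lemma euler_unit c : (0 < c)%N -> euler c \is a GRing.unit.
Proof. exact: qprod_unit. Qed.

(** The factor 1 - q cancels, and (-q; q^2)_infinity (q; q^2)_infinity = (q^2; q^4)_infinity leads
    to Euler products in q^2. *)
Lemma b_even : (bser + twist bser) * euler 2 ^+ 4 = euler 4 ^+ 5 *+ 2.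
Proof.
have u1 : 1 - X \is a GRing.unit by rewrite -mulN1r -[X]expr1 unit_1DX.
have := psi11_X; rewrite psi11_X_b -mulrA => /(mulrI u1).
rewrite [_ * qprod 1 1 2]mulrC qprod_pm // => e0.
have e1 := @euler_odd 2 isT; have e2 := @euler_neg 2 isT.
rewrite /muln /= in e0 e1 e2.
transitivity ((bser + twist bser) * qprod (-1) 2 4 ^+ 2 *
  (euler 2 ^+ 2 * euler 4 ^+ 2)); first by rewrite -e1; ring.
rewrite e0 -!e2; ring.
Qed.

(** Dictionary: [theta (-1) c (2 * c)] is phi(-q^c), [theta 1 c (2 * c)] is phi(q^c), and
    [theta 1 c (4 * c)] is psi(q^c). *)
Lemma phi_euler c : (0 < c)%N ->
  theta (-1) c (2 * c) = euler (2 * c) * qprod (-1) c (2 * c) ^+ 2.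
Proof.
move=> c0; rewrite triple_product ?mulrNN ?mulr1 //; last by lia.
by have -> : (2 * c - c = c)%N by lia.
Qed.

Lemma phi_eulerM c : (0 < c)%N ->
  theta (-1) c (2 * c) * euler (2 * c) = euler c ^+ 2.
Proof. by move=> c0; rewrite phi_euler // -(euler_odd c0); ring. Qed.

Lemma phip_euler c : (0 < c)%N ->
  theta 1 c (2 * c) = euler (2 * c) * qprod 1 c (2 * c) ^+ 2.
Proof.
move=> c0; rewrite triple_product ?mulr1 //; last by lia.
by have -> : (2 * c - c = c)%N by lia.
Qed.

Lemma psi_euler c : (0 < c)%N ->
  theta 1 c (4 * c) = euler (4 * c) * qprod 1 c (2 * c).
Proof.
move=> c0; rewrite triple_product ?mulr1 //; last by lia.
rewrite -(qprod_mod2 1 c (_ : (0 < 2 * c)%N)); last by lia.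
by rewrite mulnA; congr (_ * (_ * qprod _ _ _)); lia.
Qed.

Lemma psi_eulerM c : (0 < c)%N ->
  theta 1 c (4 * c) * euler c = euler (2 * c) ^+ 2.
Proof.
move=> c0; have c20 : (0 < 2 * c)%N by lia.
rewrite psi_euler // -(euler_odd c0).
have := qprod_pm c c20; have := euler_odd c20; rewrite !mulnA -![(2 * 2)%N]/4%N => h1 h2.
transitivity (euler (4 * c) * (qprod 1 c (2 * c) * qprod (-1) c (2 * c)) *
  euler (2 * c)); first by ring.
by rewrite h2 [euler (4 * c) * _]mulrC h1 expr2.
Qed.

(** After the triple product, the factors that are not Euler products cancel by Euler's identity
    (-q; q)_infinity (q; q^2)_infinity = 1, which is [go]. The right side is that of [theta_s_a] at
    3c, whence P w = s a. *)
Lemma theta_P_w c : (0 < c)%N ->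
  theta 1 c (3 * c) * theta (-1) (5 * c) (6 * c) =
  euler (3 * c) * euler (6 * c).
Proof.
move=> c0; have go k : (0 < k)%N -> qprod 1 k k * qprod (-1) k (2 * k) = 1.
  move=> k0; have k20 : (0 < 2 * k)%N by lia.
  apply: (mulIr (euler_unit k0)); rewrite mul1r mulrAC euler_neg // mulrC.
  exact: euler_odd.
have c30 : (0 < 3 * c)%N by lia.
have P : theta 1 c (3 * c) * qprod 1 (3 * c) (3 * c) =
    euler (3 * c) * qprod 1 c c.
  rewrite triple_product ?mulr1 //; last by lia.
  rewrite -(qprod_mod3 _ c c0) -!mulrA.
  by congr (_ * (_ * (qprod _ _ _ * qprod _ _ _))); lia.
have w : theta (-1) (5 * c) (6 * c) * qprod (-1) (3 * c) (2 * (3 * c)) =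
    euler (6 * c) * qprod (-1) c (2 * c).
  rewrite triple_product ?mulrNN ?mulr1 //; [|lia|lia].
  have c20 : (0 < 2 * c)%N by lia.
  have := qprod_mod3 (-1) c c20.
  have [-> -> ->] : [/\ 3 * (2 * c) = 6 * c, c + 2 * c = 3 * c &
    c + 2 * (2 * c) = 5 * c]%N by split; ring.
  have -> : (6 * c - 5 * c = c)%N by lia.
  have -> : (2 * (3 * c) = 6 * c)%N by lia.
  by move=> <-; ring.
transitivity (theta 1 c (3 * c) * theta (-1) (5 * c) (6 * c) *
   (qprod 1 (3 * c) (3 * c) * qprod (-1) (3 * c) (2 * (3 * c)))).
  by rewrite go // mulr1.
by rewrite mulrACA P w mulrACA go // mulr1.
Qed.

Lemma theta_s_a c : (0 < c)%N ->
  theta 1 c (4 * c) * theta (-1) c (2 * c) = euler c * euler (2 * c).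
Proof.
move=> c0; have c20 : (0 < 2 * c)%N by lia.
apply: (mulIr (euler_unit c0)); apply: (mulIr (euler_unit c20)).
rewrite -!mulrA [_ * (euler c * _)]mulrCA !mulrA psi_eulerM // -mulrA.
by rewrite phi_eulerM //; ring.
Qed.

Lemma b_even_theta :
  (bser + twist bser) * theta (-1) 2 4 = theta 1 2 8 ^+ 2 *+ 2.
Proof.
have e1 := @phi_eulerM 2 isT; have e2 := @psi_eulerM 2 isT.
rewrite /muln /= in e1 e2; have e0 := b_even.
apply: (mulIr (euler_unit (isT : 0 < 4)%N)).
have u2 : euler 2 ^+ 2 \is a GRing.unit by rewrite unitrX ?euler_unit.
apply: (mulIr u2); rewrite -!mulrA [theta (-1) _ _ * _]mulrA e1 -exprD e0.
by transitivity (euler 4 * (theta 1 2 8 * euler 2) ^+ 2 *+ 2); [rewrite e2; ring|ring].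
Qed.

Lemma psi_sqr c : (0 < c)%N ->
  theta 1 c (4 * c) ^+ 2 = theta 1 c (2 * c) * theta 1 (2 * c) (4 * (2 * c)).
Proof.
move=> c0; have c20 : (0 < 2 * c)%N by lia.
apply: (mulIr (euler_unit c20)).
rewrite -[RHS]mulrA psi_eulerM // psi_euler // phip_euler // mulnA; ring.
Qed.

(** * Shift and residue classes of one-sided theta series *)

Lemma theta_sum_shift e r M : (0 < r)%N ->
  theta_sum e r M = 1 + e * X ^+ r * theta_sum e (r + M) M.
Proof.
move=> r0; have rM0 : (0 < r + M)%N by lia.
apply: cvg_uniq (cvg_sub (h := succn) _ (theta_sum_cvg e M r0)) _ => //.
apply: cvg_ext (cvgD (cvg_const 1) (cvgM (cvg_const _) (theta_sum_cvg e M rM0))) => n.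
rewrite /theta_sum_trunc big_ord_recl !muln0 mulr1; congr (_ + _).
rewrite mulr_sumr; apply: eq_bigr => i _ /=.
rewrite /bump /= add1n binS bin1 exprS mulrACA -exprD; congr (_ * _ ^+ _); ring.
Qed.

Lemma bin2M i d : 'C(i * d, 2) = (d * d * 'C(i, 2) + i * 'C(d, 2))%N.
Proof.
elim: i => [|i IH]; first by rewrite muln0.
by rewrite mulSnr binD2 IH binS bin1; ring.
Qed.

Lemma theta_sum_mod d e r M : (0 < d)%N -> (0 < r)%N ->
  theta_sum e r M = \sum_(j < d) e ^+ j * X ^+ (M * 'C(j, 2) + r * j) *
    theta_sum (e ^+ d) (d * r + M * 'C(d, 2) + M * d * j) (d * d * M).
Proof.
move=> d0 r0; have hd n : (n <= n * d)%N by rewrite leq_pmulr.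
have rj0 j : (0 < d * r + M * 'C(d, 2) + M * d * j)%N by rewrite !addn_gt0 muln_gt0 d0 r0.
apply: cvg_uniq (cvg_sub hd (theta_sum_cvg e M r0)) _.
pose c j : fps := e ^+ j * X ^+ (M * 'C(j, 2) + r * j).
have cP j (_ : (j < d)%N) := cvgM (cvg_const (c j))
  (theta_sum_cvg (e ^+ d) (d * d * M) (rj0 j)).
apply: cvg_ext (cvg_sum cP) => n; rewrite /c {cP c}.
rewrite /theta_sum_trunc.
rewrite (big_ord_mod _ _ _ (fun k => e ^+ k * X ^+ (M * 'C(k, 2) + r * k))).
apply: eq_bigr => j _; rewrite mulr_sumr; apply: eq_bigr => i _ /=.
rewrite mulrACA -exprM -!exprD addnC mulnC; congr (_ * _ ^+ _).
rewrite binD2 bin2M; ring.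
Qed.

(** * Dissections *)

Lemma theta_sum_mod2 e r M : (0 < r)%N ->
  theta_sum e r M = theta_sum (e ^+ 2) (2 * r + M) (4 * M)
    + e * X ^+ r * theta_sum (e ^+ 2) (2 * r + 3 * M) (4 * M).
Proof.
move=> r0; have := theta_sum_mod e M (isT : (0 < 2)%N) r0.
rewrite !big_ord_recl big_ord0 => ->.
rewrite expr0 !muln0 !mul1r expr1 addr0; congr (_ + _ * _ ^+ _ * _).
- congr (theta_sum _ _ _); rewrite binn; ring.
- by rewrite /= /bump /= addn0 muln1.
- by congr (theta_sum _ _ _); rewrite /= /bump binn /=; ring.
Qed.

Lemma theta_sum_mod3 e r M : (0 < r)%N ->
  theta_sum e r M = theta_sum (e ^+ 3) (3 * r + 3 * M) (9 * M)
    + e * X ^+ r * theta_sum (e ^+ 3) (3 * r + 6 * M) (9 * M)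
    + e ^+ 2 * X ^+ (M + 2 * r) * theta_sum (e ^+ 3) (3 * r + 9 * M) (9 * M).
Proof.
move=> r0; have := theta_sum_mod e M (isT : (0 < 3)%N) r0.
have c3 : 'C(3, 2) = 3%N by [].
rewrite !big_ord_recl big_ord0 c3 => ->.
rewrite expr0 !muln0 !mul1r expr1 addr0 addrA.
congr (_ + _ * _ ^+ _ * _ + _ * _ ^+ _ * _).
- congr (theta_sum _ _ _); ring.
- by rewrite /= /bump /= addn0 muln1.
- by congr (theta_sum _ _ _); rewrite /= /bump /=; ring.
- by rewrite /= /bump /= binn; ring.
- by congr (theta_sum _ _ _); rewrite /= /bump /=; ring.
Qed.

(** Among the exponents c k^2, the multiples of 3 give phi(-q^(9c)); the two other classes of k are
    exchanged by k -> -k, hence the factor 2. *)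
Lemma phi_mod3 c : (0 < c)%N ->
  theta (-1) c (2 * c) = theta (-1) (9 * c) (18 * c)
    - X ^+ c * theta (-1) (15 * c) (18 * c) *+ 2.
Proof.
move=> c0; have c30 : (0 < 3 * c)%N by lia.
have e3 : (-1 : fps) ^+ 3 = -1 by rewrite -signr_odd.
rewrite /theta.
have [-> -> ->] : [/\ 2 * c - c = c, 18 * c - 9 * c = 9 * c &
  18 * c - 15 * c = 3 * c]%N by split; lia.
(* The class k = 2 mod 3 of the one-sided sum is [theta_sum _ (3 * c) _] without its initial term;
   the shift accounts for that term. *)
rewrite theta_sum_mod3 // [theta_sum _ (3 * c) _]theta_sum_shift // e3.
have [-> -> ->] : [/\ 3 * c + 3 * (2 * c) = 9 * c, 9 * (2 * c) = 18 * c &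
  3 * c + 6 * (2 * c) = 15 * c]%N by split; ring.
have -> : (2 * c + 2 * c = c + 3 * c)%N by ring.
rewrite exprD; ring.
Qed.

(** As k runs over all integers, k(2k-1) takes each triangular number once; the even and odd indices
    of the one-sided sum are the two halves of the bilateral one. *)
Lemma psi_theta_sum c : (0 < c)%N -> theta 1 c (4 * c) = theta_sum 1 c c.
Proof.
move=> c0; rewrite [RHS]theta_sum_mod2 // expr1n /theta.
rewrite [theta_sum 1 c (4 * c)]theta_sum_shift //.
have [-> -> ->] : [/\ 4 * c - c = 3 * c, 2 * c + c = 3 * c &
  2 * c + 3 * c = c + 4 * c]%N by split; lia.
ring.
Qed.

(** In the sum over triangular numbers, the indices 1 mod 3 give q^c psi(q^(9c)); the two other
    classes are the halves of [theta 1 (3 * c) (9 * c)]. *)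
Lemma psi_mod3 c : (0 < c)%N ->
  theta 1 c (4 * c) = theta 1 (3 * c) (9 * c) + X ^+ c * theta 1 (9 * c) (36 * c).
Proof.
move=> c0; have c30 : (0 < 3 * c)%N by lia.
have c90 : (0 < 9 * c)%N by lia.
have <- : (4 * (9 * c) = 36 * c)%N by ring.
rewrite !psi_theta_sum // [LHS]theta_sum_mod3 // !expr1n /theta.
rewrite [theta_sum 1 (3 * c) (9 * c)]theta_sum_shift //.
have [-> -> -> ->] : [/\ 9 * c - 3 * c = 6 * c, 3 * c + 3 * c = 6 * c,
  3 * c + 6 * c = 9 * c & c + 2 * c = 3 * c]%N by split; lia.
ring.
Qed.

(** Even k give phi(q^(4c)), odd k give 2 e q^c psi(q^(8c)). Both signs of [e] are wanted, since the
    product of the two cases is a difference of squares. *)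
Lemma phi_mod2 (e : fps) c : e * e = 1 -> (0 < c)%N ->
  theta e c (2 * c) = theta 1 (4 * c) (8 * c)
    + e * X ^+ c * theta_sum 1 (8 * c) (8 * c) *+ 2.
Proof.
move=> e2 c0; rewrite /theta.
have [-> ->] : [/\ 2 * c - c = c & 8 * c - 4 * c = 4 * c]%N by split; lia.
rewrite theta_sum_mod2 // expr2 e2.
have [-> -> ->] : [/\ 2 * c + 2 * c = 4 * c, 4 * (2 * c) = 8 * c &
  2 * c + 3 * (2 * c) = 8 * c]%N by split; ring.
ring.
Qed.

(** * Extraction of residue classes of exponents *)

Definition supported d (f : fps) := forall n, ~~ (d %| n)%N -> f n = 0.

Definition residue_part d r (f : fps) : fps :=
  fun n => if (n %% d == r)%N then f n else 0.

Lemma supported1 d : supported d 1.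
Proof. by move=> [|n]; rewrite ?dvdn0. Qed.

Lemma supportedX d k : (d %| k)%N -> supported d (X ^+ k).
Proof. by move=> dk n dn; rewrite fcoefX; case: eqP dn => // ->; rewrite dk. Qed.

Lemma supportedN d f : supported d f -> supported d (- f).
Proof. by move=> fs n dn; rewrite fcoefN fs. Qed.

Lemma supportedD d f g : supported d f -> supported d g -> supported d (f + g).
Proof. by move=> fs gs n dn; rewrite fcoefD fs ?gs. Qed.

Lemma supportedM d f g : supported d f -> supported d g -> supported d (f * g).
Proof.
move=> fs gs n dn; rewrite fcoefM big1 // => i _.
have [di|di] := boolP (d %| i)%N; last by rewrite fs ?mul0r.
by rewrite gs ?mulr0 // dvdn_subl //; have := ltn_ord i; lia.
Qed.

Lemma supportedMn d f k : supported d f -> supported d (f *+ k).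
Proof. by move=> fs n dn; rewrite fcoefMn fs ?mul0rn. Qed.

Lemma supported_exp d f k : supported d f -> supported d (f ^+ k).
Proof.
move=> fs; elim: k => [|k IH]; first exact: supported1.
by rewrite exprS; apply: supportedM.
Qed.

Lemma supported_sum d n (F : nat -> fps) : (forall i, supported d (F i)) ->
  supported d (\sum_(i < n) F i).
Proof. by move=> Fs k dk; rewrite fcoef_sum big1 // => i _; apply: Fs. Qed.

Lemma supported_cvg d s f : cvg_fps s f -> (forall n, supported d (s n)) ->
  supported d f.
Proof.
by move=> sf ss n dn; have [M Ms] := sf n.+1; rewrite -(Ms M) ?ss.
Qed.

Lemma theta_sum_supported d e r M : (0 < r)%N -> supported d e ->
  (d %| r)%N -> (d %| M)%N -> supported d (theta_sum e r M).
Proof.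
move=> r0 es dr dM; apply: supported_cvg (theta_sum_cvg e M r0) _ => n.
apply: (supported_sum n (F := fun k => e ^+ k * X ^+ (M * 'C(k, 2) + r * k))) => k.
apply: supportedM (supported_exp _ es) (supportedX _).
by rewrite dvdn_add // dvdn_mulr.
Qed.

Lemma theta_supported d e r M : (0 < r)%N -> (r < M)%N -> supported d e ->
  (d %| r)%N -> (d %| M)%N -> supported d (theta e r M).
Proof.
move=> r0 rM es dr dM; rewrite /theta.
apply: supportedD (supportedD _ _) (supportedN (@supported1 d)).
  exact: theta_sum_supported.
by apply: theta_sum_supported => //; [lia | rewrite dvdn_subr // ltnW].
Qed.

Lemma residue_partD d r f g :
  residue_part d r (f + g) = residue_part d r f + residue_part d r g.
Proof.
apply/funext => n; rewrite fcoefD /residue_part; case: ifP => //.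
Qed.

(** Extraction is linear over series in q^d, so it commutes with clearing a denominator supported on
    multiples of [d]. *)
Lemma residue_partM d r f g : supported d g ->
  residue_part d r (f * g) = residue_part d r f * g.
Proof.
move=> gs; rewrite (mulrC f g) [RHS]mulrC; apply/funext => n.
transitivity (\sum_(i < n.+1) g i * (if (n %% d == r)%N then f (n - i)%N else 0)).
  rewrite /residue_part; case: ifP => // _.
  by rewrite big1 // => i _; rewrite mulr0.
rewrite fcoefM; apply: eq_bigr => i _.
have [di|di] := boolP (d %| i)%N; last by rewrite gs ?mul0r.
suff <- : ((n - i) %% d = n %% d)%N by [].
have in_ : (i <= n)%N by have := ltn_ord i; lia.
by rewrite -[in RHS](subnK in_) -modnDmr (eqP di) addn0.
Qed.

Lemma residue_partX d r k f : supported d f ->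
  residue_part d r (X ^+ k * f) = if (k %% d == r)%N then X ^+ k * f else 0.
Proof.
move=> fs; apply/funext => n; rewrite /residue_part.
have [kn|kn] := ltnP n k; first by case: ifP; case: ifP; rewrite ?fcoefXM ?kn.
have [dnk|dnk] := boolP (d %| n - k)%N.
  have -> : (n %% d = k %% d)%N.
    by rewrite -{1}(subnK kn) -modnDml (eqP dnk).
  by case: ifP.
have z : (X ^+ k * f) n = 0 by rewrite fcoefXM ltnNge kn fs.
by rewrite z; do 2!case: ifP.
Qed.

Lemma residue_part0 d r f : supported d f -> (0 < r)%N -> residue_part d r f = 0.
Proof.
move=> fs r0; have := residue_partX r 0 fs.
by rewrite expr0 mul1r mod0n eq_sym gtn_eqF.
Qed.

(** * Congruences for [b] *)

Lemma fcoef0_theta e r M : theta e r M 0%N = 1.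
Proof.
have sum0 k : theta_sum e k M 0%N = 1.
  by rewrite /theta_sum /lim_fps /theta_sum_trunc big_ord1 !muln0 mulr1.
by rewrite /theta !fcoefD fcoefN !sum0.
Qed.

Lemma theta_sum_coef0 r M n : (0 < r)%N ->
  (forall k, M * 'C(k, 2) + r * k <> n)%N -> theta_sum 1 r M n = 0.
Proof.
move=> r0 nk; have [K KP] := theta_sum_cvg 1 M r0 n.+1.
rewrite -(KP K) // /theta_sum_trunc fcoef_sum big1 // => k _.
by rewrite expr1n mul1r fcoefX; case: eqP => // /esym/nk.
Qed.

Lemma b_even_coef n : ~~ odd n -> (bser + twist bser) n = b n *+ 2.
Proof.
by move=> /negPf n2; rewrite fcoefD /twist -signr_odd n2 mul1r mulr2n.
Qed.

(** At even exponents B(q) + B(-q) has coefficients 2 b(n), so the modulus is halved at the end. *)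
Lemma dvdz_of_double (m : nat) (x z : int) : x *+ 2 = z *+ (2 * m) -> (m %| x)%Z.
Proof.
move=> e; apply/dvdzP; exists z; move: e.
by rewrite -[x *+ 2]mulr_natr -[z *+ _]mulr_natr !natz PoszM; lia.
Qed.

(** All series are in q^2, so the class 2 mod 3 becomes 4 mod 6. *)
Lemma b_mod9 t : (9 %| b (6 * t + 4)%N)%Z.
Proof.
pose a := theta (-1) 18 36; pose w := theta (-1) 30 36.
pose P := theta 1 6 18; pose s := theta 1 18 72; pose S := bser + twist bser.
have s1 : supported 6 1 := @supported1 6.
have sN1 : supported 6 (-1) := supportedN s1.
have sa : supported 6 a by apply: theta_supported.
have sw : supported 6 w by apply: theta_supported.
have sP : supported 6 P by apply: theta_supported.
have ss : supported 6 s by apply: theta_supported.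
have aE : theta (-1) 2 4 = a - X ^+ 2 * w *+ 2 by exact: (@phi_mod3 2).
have sE : theta 1 2 8 = P + X ^+ 2 * s by exact: (@psi_mod3 2).
have Pw : P * w = s * a.
  have := @theta_P_w 6 isT; rewrite -[RHS](@theta_s_a 18 isT); exact.
have := b_even_theta; rewrite -/S aE sE => e0.
(* [D] is a - 2 X^2 w times its cofactor in the difference of cubes; it is a series in q^6. *)
pose D := a ^+ 3 - X ^+ 6 * w ^+ 3 *+ 8.
have sD : supported 6 D.
  apply: supportedD; first exact: supported_exp.
  apply/supportedN/supportedMn.
  by apply: supportedM; [apply: supportedX | apply: supported_exp].
have e1 : S * D = P ^+ 2 * a ^+ 2 *+ 2
    + X ^+ 2 * ((P ^+ 2 * a * w + P * s * a ^+ 2) *+ 4)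
    + X ^+ 4 * ((s * a) ^+ 2 *+ 18)
    + X ^+ 6 * (P * s * w ^+ 2 *+ 16 + s ^+ 2 * a * w *+ 4)
    + X ^+ 8 * (s ^+ 2 * w ^+ 2 *+ 8).
  (* The coefficient of X^4 arises as 8 (Pw)^2 + 8 (Pw)(sa) + 2 (sa)^2, and P w = s a merges the
     three into 18 (sa)^2. *)
  have -> : (s * a) ^+ 2 *+ 18 =
      (P * w) ^+ 2 *+ 8 + (P * w) * (s * a) *+ 8 + (s * a) ^+ 2 *+ 2.
    by rewrite Pw; ring.
  transitivity (S * (a - X ^+ 2 * w *+ 2) *
    (a ^+ 2 + X ^+ 2 * (a * w) *+ 2 + X ^+ 4 * w ^+ 2 *+ 4)).
    by rewrite /D; ring.
  by rewrite e0; ring.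
have e2 : residue_part 6 4 S * D = X ^+ 4 * ((s * a) ^+ 2 *+ 18).
  rewrite -residue_partM // e1 !residue_partD.
  rewrite residue_part0 // ?residue_partX; first by rewrite /= !add0r !addr0.
  all: repeat first [assumption | apply: supportedMn | apply: supportedM |
    apply: supported_exp | apply: supportedD].
have D0 : D 0%N = 1.
  rewrite /D fcoefD fcoefN fcoefMn fcoefXM mul0rn subr0 !exprS !fcoefM0.
  by rewrite /a fcoef0_theta.
have uD := fps_unit D0.
have e3 : residue_part 6 4 S = X ^+ 4 * (s * a) ^+ 2 / D *+ 18.
  by apply: (mulIr uD); rewrite e2 mulrnAl divrK // mulrnAr.
have := congr1 (fun f : fps => f (6 * t + 4)%N) e3.
rewrite fcoefMn /residue_part ifT; last by rewrite mulnC modnMDl.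
rewrite /S b_even_coef; last by rewrite oddD oddM.
exact: (@dvdz_of_double 9).
Qed.

(** The class 0 mod 4 of B(q) + B(-q) is 2 psi(q^4) plus 16 times an integral series, and the
    hypothesis that n is not triangular removes the first part. *)
Lemma b_mod8 n : (forall k, k * k.+1 != 2 * n)%N -> (8 %| b (4 * n)%N)%Z.
Proof.
move=> nT.
pose al := theta 1 8 16; pose be := theta_sum 1 16 16.
pose psi4 := theta 1 4 16; pose S := bser + twist bser.
have s1 : supported 4 1 := @supported1 4.
have sal : supported 4 al by apply: theta_supported.
have sbe : supported 4 be by apply: theta_sum_supported.
have sp : supported 4 psi4 by apply: theta_supported.
have mE : theta (-1) 2 4 = al - X ^+ 2 * be *+ 2.
  rewrite (@phi_mod2 (-1) 2) ?mulrNN ?mulr1 // -/al -/be; ring.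
have pE : theta 1 2 4 = al + X ^+ 2 * be *+ 2.
  rewrite (@phi_mod2 1 2) ?mulr1 // -/al -/be; ring.
have := b_even_theta; rewrite -/S (@psi_sqr 2 isT) mE pE.
rewrite -[theta 1 (2 * 2) _]/psi4 => e0.
pose D := al ^+ 2 - X ^+ 4 * be ^+ 2 *+ 4.
have sD : supported 4 D.
  apply: supportedD; first exact: supported_exp.
  apply/supportedN/supportedMn.
  by apply: supportedM; [apply: supportedX | apply: supported_exp].
(* With x = X^2 be, (al + 2x)^2 = D + 4 al x + 8 x^2; the middle term lies in the class 2 mod 4. *)
have e1 : S * D = psi4 * D *+ 2 + X ^+ 2 * (psi4 * al * be *+ 8)
    + X ^+ 4 * (psi4 * be ^+ 2 *+ 16).
  transitivity (S * (al - X ^+ 2 * be *+ 2) * (al + X ^+ 2 * be *+ 2)).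
    by rewrite /D; ring.
  by rewrite e0 /D; ring.
have section0 f : supported 4 f -> residue_part 4 0 f = f.
  by move=> fs; have := residue_partX 0 0 fs; rewrite expr0 mul1r.
have e2 : residue_part 4 0 S * D =
    psi4 * D *+ 2 + X ^+ 4 * (psi4 * be ^+ 2 *+ 16).
  rewrite -residue_partM // e1 !residue_partD.
  rewrite section0 ?residue_partX; first by rewrite /= addr0.
  all: repeat first [assumption | apply: supportedMn | apply: supportedM |
    apply: supported_exp | apply: supportedD].
have D0 : D 0%N = 1.
  rewrite /D fcoefD fcoefN fcoefMn fcoefXM mul0rn subr0 !exprS !fcoefM0.
  by rewrite /al fcoef0_theta.
have uD := fps_unit D0.
have e3 : residue_part 4 0 S = psi4 *+ 2 + X ^+ 4 * psi4 * be ^+ 2 / D *+ 16.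
  apply: (mulIr uD); rewrite e2 [RHS]mulrDl [psi4 *+ 2 * D]mulrnAl mulrnAl.
  by rewrite divrK // mulrnAr mulrA.
have := congr1 (fun f : fps => f (4 * n)%N) e3.
rewrite fcoefD !fcoefMn /residue_part modnMr eqxx /S b_even_coef; last by rewrite oddM.
(* The exponents of psi(q^4) are 4 times the triangular numbers. *)
have -> : psi4 (4 * n)%N = 0.
  rewrite /psi4 (@psi_theta_sum 4 isT) theta_sum_coef0 // => k.
  by have /eqP := nT k; have := bin2_double k; nia.
rewrite mul0rn add0r.
exact: (@dvdz_of_double 8).
Qed.

(** * Arithmetic of the index and conclusion *)

Lemma odd_sqr_mod8 m : odd m -> exists j, (m * m = 8 * j + 1)%N.
Proof.
(* With m = 2h + 1 the witness is the triangular number h(h+1)/2. *)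
move=> mo; exists ('C(m./2, 2) + m./2)%N.
by have := bin2_double m./2; have := odd_double_half m; rewrite mo -mul2n; nia.
Qed.

Lemma sqr_mod3 m : (m * m %% 3 != 2)%N.
Proof.
have : (m %% 3 < 3)%N by rewrite ltn_mod.
by rewrite -modnMm; case: (m %% 3)%N => [|[|[|]]].
Qed.

Theorem theorem1p13 (p : nat) (hp : prime p) (hp3 : (3 <= p)%N) (n k : nat) :
  (72 %| b (108 * p ^ (2 * nu p * k) * n + (153 * p ^ (2 * nu p * k) - 1) %/ 2)%N)%Z.
Proof.
have p_odd : odd p by case/even_prime: hp => // p2; rewrite p2 in hp3.
(* The power of p is the square of an odd number [R], so R^2 = 8j + 1 and the division by 2 in the
   index is exact. *)
have -> : (p ^ (2 * nu p * k) = p ^ (nu p * k) * p ^ (nu p * k))%N.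
  by rewrite -expnD; congr (p ^ _)%N; ring.
have R_odd : odd (p ^ (nu p * k)) by rewrite oddX p_odd orbT.
move: (p ^ (nu p * k))%N R_odd => R R_odd.
have [j jR] := odd_sqr_mod8 R_odd.
have -> : ((153 * (R * R) - 1) %/ 2 = 612 * j + 76)%N by rewrite jR; lia.
set N := (_ + _)%N.
have [N9 N8] : (N = 6 * (18 * (R * R) * n + 102 * j + 12) + 4 /\
    N = 4 * (27 * (R * R) * n + 153 * j + 19))%N by rewrite /N; split; ring.
rewrite (@Gauss_dvdz 8 9) //; apply/andP; split; last by rewrite N9 b_mod9.
rewrite N8; apply: b_mod8 => m; apply/eqP => mT.
(* If N/4 were the triangular number m(m+1)/2, then 8 (N/4) + 1 = (2m+1)^2; here it equals 9 R^2
   (24n + 17). *)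
have sq : ((2 * m + 1) * (2 * m + 1) = 3 * R * (3 * R) * (24 * n + 17))%N by nia.
have R0 : (0 < 3 * R)%N by case: (R) R_odd.
have : (3 * R %| 2 * m + 1)%N.
  by rewrite -(@dvdn_pexp2r _ _ 2) // -!mulnn sq dvdn_mulr.
case/dvdnP => l lE.
(* Dividing by (3R)^2 makes 24n + 17 a square, although it is 2 mod 3. *)
have lsq : (l * l = (8 * n + 5) * 3 + 2)%N.
  have RR0 : (0 < 3 * R * (3 * R))%N by rewrite muln_gt0 R0.
  apply/eqP; rewrite -(eqn_pmul2l RR0).
  have -> : ((8 * n + 5) * 3 + 2 = 24 * n + 17)%N by ring.
  by rewrite -sq lE; apply/eqP; ring.
by have := sqr_mod3 l; rewrite lsq modnMDl.
Qed.
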